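(* For all integers $r \geq 3$ and $q \geq 2$, $\delta_{r,q} \leq \frac{r}{r+1}$.
   Context: A $q$-edge-colored graph is a pair $(G,f)$ with $f: E(G) \to [q]$. For a $q$-edge-colored graph $(F,f)$, its discrepancy is the largest $t$ such that some color $c \in [q]$ appears on at least $\frac{e(F)+t}{q}$ edges of $F$. A $K_r$-tiling of a graph $G$ is a collection of vertex-disjoint copies of $K_r$ in $G$ whose vertex sets partition $V(G)$; its discrepancy is that of the edge-colored graph formed by the union of its copies. For $r \geq 3$, $q \geq 2$, $\delta_{r,q}$ is the infimum of those $\delta > 0$ for which there exists $\zeta > 0$ such that for all sufficiently large $n$, for every $n$-vertex graph $G$ with $r \mid n$ and minimum degree $\delta(G) \geq \delta n$, and every coloring $f: E(G) \to [q]$, there is a $K_r$-tiling of $G$ whose discrepancy (with respect to $f$) is at least $\zeta n$. *)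

(* Defs.v *)
From mathcomp Require Import all_boot all_order all_algebra.
From mathcomp Require Import boolp classical_sets reals.

Set Implicit Arguments.
Unset Strict Implicit.
Unset Printing Implicit Defensive.

Import Order.TTheory GRing.Theory Num.Theory.

Local Open Scope ring_scope.

Record sgraph (V : finType) := SGraph {
  adj :> rel V;
  adj_sym : symmetric adj;
  adj_irr : irreflexive adj
}.

Section Graphs.
Variable V : finType.
Implicit Types (G : sgraph V) (P : {set {set V}}).

Definition edges G : {set {set V}} :=
  ([set [set x.1; x.2] | x : V * V & adj G x.1 x.2])%SET.

Definition degree G (v : V) : nat := #|[set u | adj G v u]%SET|.

(* Every degree is at most #|V|, so the default value of the iterated minimum
   plays no role unless V is empty. *)
Definition min_degree G : nat := (\big[minn/#|V|]_(v : V) degree G v)%N.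

Definition clique G (B : {set V}) : bool :=
  [forall x in B, forall y in B, (x != y) ==> adj G x y].

(* A copy of K_r in a simple graph is determined by its vertex set, a clique on
   r vertices, so a tiling is recorded as the set of those vertex sets. *)
Definition Kr_tiling (r : nat) G P : bool :=
  finset.partition P [set: V]%SET && [forall B in P, (#|B| == r) && clique G B].

Definition tiling_adj P : rel V :=
  fun x y => (x != y) && [exists B in P, (x \in B) && (y \in B)].

Fact tiling_adj_sym P : symmetric (tiling_adj P).
Proof.
move=> x y; rewrite /tiling_adj eq_sym; congr (_ && _).
by apply: eq_existsb => B; rewrite [(x \in B) && _]andbC.
Qed.

Fact tiling_adj_irr P : irreflexive (tiling_adj P).
Proof. by move=> x; rewrite /tiling_adj eqxx. Qed.

(* The union of the complete graphs on the members of P. *)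
Definition tiling_graph P : sgraph V :=
  SGraph (@tiling_adj_sym P) (@tiling_adj_irr P).

Lemma tiling_graph_sub r G P : Kr_tiling r G P ->
  forall x y, adj (tiling_graph P) x y -> adj G x y.
Proof.
move=> /andP[_ /forall_inP tP] x y /andP[xy /exists_inP[B BP /andP[xB yB]]].
have /andP[_ /forall_inP /(_ x xB) /forall_inP /(_ y yB)] := tP B BP.
by rewrite xy.
Qed.

Lemma degree_lt G v : (degree G v < #|V|)%N.
Proof.
have /subset_leq_card : ([set u | adj G v u] \subset [set~ v])%SET.
  apply/fintype.subsetP => u; rewrite !inE; apply: contraTN => /eqP ->.
  by rewrite adj_irr.
rewrite cardsC1 => /leq_ltn_trans -> //; rewrite prednK //.
by apply/card_gt0P; exists v.
Qed.

Lemma min_degree_le G v : (min_degree G <= degree G v)%N.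
Proof.
rewrite /min_degree; have := mem_index_enum v.
elim: (index_enum V) => //= u s IHs; rewrite inE big_cons geq_min.
by case/predU1P => [->|/IHs ->]; rewrite ?leqnn ?orbT.
Qed.

End Graphs.

Section Discrepancy.
Variables (R : realType) (V : finType) (q : nat).
Implicit Types (F : sgraph V) (c : 'I_q).

(* A q-edge-coloring of F is given by a function defined on all sets of
   vertices, of which only the values on edges F are used; the same f thus
   also colors every subgraph of F. *)
Implicit Type f : {set V} -> 'I_q.

Definition color_class F f c : {set {set V}} := [set e in edges F | f e == c]%SET.

Definition discrepancy_set F f : set R :=
  [set t : R | exists c, (#|edges F|%:R + t) / q%:R <= #|color_class F f c|%:R]%classic.

(* A largest element, see discrepancy_max. *)
Definition discrepancy F f : R := sup (discrepancy_set F f).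

Lemma discrepancy_max F f : (0 < q)%N ->
  discrepancy_set F f (discrepancy F f) /\
  ubound (discrepancy_set F f) (discrepancy F f).
Proof.
move=> q0; have qR : 0 < q%:R :> R by rewrite ltr0n.
pose m c : R := q%:R * #|color_class F f c|%:R - #|edges F|%:R.
have mE t c : ((#|edges F|%:R + t) / q%:R <= #|color_class F f c|%:R) = (t <= m c).
  by rewrite ler_pdivrMr // /m lerBrDl [X in _ <= X]mulrC.
have [c _ cmax] := @Order.TotalTheory.arg_maxP _ _ _ (Ordinal q0) predT m isT.
have cS : discrepancy_set F f (m c) by exists c; rewrite mE.
have cU : ubound (discrepancy_set F f) (m c).
  by move=> t [c']; rewrite mE => /le_trans; apply; exact: cmax.
suff -> : discrepancy F f = m c by [].
apply/eqP; rewrite eq_le; apply/andP; split.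
  by apply: ge_sup => //; exists (m c).
by apply: ub_le_sup => //; exists (m c).
Qed.

End Discrepancy.

Section Threshold.
Variables (R : realType) (r q : nat).

Definition tiling_discrepancy_set : set R :=
  [set delta : R | 0 < delta /\
    exists zeta : R, 0 < zeta /\
    exists n0 : nat, forall n : nat, (n0 <= n)%N -> (r %| n)%N ->
    forall (V : finType) (G : sgraph V), #|V| = n ->
      delta * n%:R <= (min_degree G)%:R ->
    forall f : {set V} -> 'I_q,
    exists P : {set {set V}}, Kr_tiling r G P /\
      zeta * n%:R <= discrepancy R (tiling_graph P) f]%classic.

Definition tiling_discrepancy_threshold : R := inf tiling_discrepancy_set.

(* The infimum of reals is thus a genuine one, not the default value 0. *)
Lemma has_inf_tiling_discrepancy_set : has_inf tiling_discrepancy_set.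
Proof.
split; last by exists 0 => delta [/ltW].
exists 1; split=> //; exists 1; split=> //; exists 1%N => n n0 _ V G Vn.
rewrite mul1r ler_nat => dG; exfalso.
have /card_gt0P[v _] : (0 < #|V|)%N by rewrite Vn.
have := leq_ltn_trans (min_degree_le G v) (degree_lt G v).
by rewrite Vn ltnNge dG.
Qed.

End Threshold.

(* Main.v *)
Require Import Defs.
From mathcomp Require Import all_boot all_order all_algebra.
From mathcomp Require Import zify.

(* If a small set of vertices (a "switcher") has two K_r-tilings with different
   numbers of edges of some color, then linearly many disjoint switchers, the
   rest being tiled by the Hajnal-Szemeredi theorem, give two tilings in which
   the numbers of edges of that color differ linearly, and one of them forces
   some color to be linearly above average.  The switchers used here are
   (A + u, B + v) and (A + v, B + u) for (r-1)-cliques A, B in the common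
   neighborhood of u and v.  If there are few disjoint ones, delete them: what
   remains is switcher-free, so f(uw), f(vw') and f(vw), f(uw') agree as
   multisets for every 4-cycle u w v w'.  Then the indicator of each color c is
   of the form 2 [f(uv) = c] = g_c(u) + g_c(v) with g_c integral, and the
   vertices where some g_c is negative form an independent set I off which f is
   constant.  Since |I| < n / (r + 1), at most (r - 1) |I| edges of a tiling
   miss this color, which is less than (1 - 1 / q) of all its edges. *)

Import Order.TTheory GRing.Theory Num.Theory.

Set Implicit Arguments.
Unset Strict Implicit.
Unset Printing Implicit Defensive.

(** * The Hajnal-Szemeredi theorem *)

(** The degree bound leaves slack on purpose: any r + 1 vertices have a common neighbor outside a
    prescribed small set, so cliques and triangles can still be built greedily after the vertices
    meeting all switchers are deleted. The integers g_c are forced. Solving the three edge equations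
    on a triangle uxy gives g_c(u) = [f(ux) = c] + [f(uy) = c] - [f(xy) = c], and the 4-cycle
    identity is what makes this independent of the triangle. Summed over c it is 1 + 1 - 1 = 1, so a
    vertex without negative values has a single color, of value 1. The last comparison, of (r - 1) /
    (r + 1) with (1 - 1 / q) (r - 1) / 2, is an equality for r = 3 and q = 2. A linear gain then
    comes only from the slack in the degree, through the bound on |I|. *)

Lemma addn_bool_cancel m (i j k : bool) : (i -> 0 < m) -> ~~ (j && i) ->
  m - i + j + k - j = m + k - i.
Proof. by case: i; case: j; case: k => //= H _; try have := H isT; clear; lia. Qed.

Section Coloring.
Variables (V C : finType) (e : rel V).
Implicit Types (f g : V -> C) (S B : {set V}) (K A : {set C}) (n : C -> nat).

Definition nbr S x := [set y in S | e x y].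
Definition cls f S c := [set x in S | f x == c].
Definition recolor f x c := fun y => if y == x then c else f y.

(** Vertex set and palette both vary because parts of the graph are recolored with disjoint palettes
    and merged; the class sizes are a function so that single surplus or missing vertices can be
    tracked. *)
Definition coloring f S K n :=
  [/\ {in S &, forall x y, e x y -> f x != f y}, {in S, forall x, f x \in K}
    & {in K, forall c, #|cls f S c| = n c}].

Lemma coloring_ext f S K n n' :
  {in K, n =1 n'} -> coloring f S K n -> coloring f S K n'.
Proof. by move=> nn' [fP fK fn]; split=> // c cK; rewrite -nn' ?fn. Qed.

Lemma coloring_restrict f S K A n : A \subset K ->
  coloring f S K n -> coloring f [set x in S | f x \in A] A n.
Proof.
move=> AK [fP fK fn]; split=> [x y|x|c cA].
- by rewrite !inE => /andP[xS _] /andP[yS _]; apply: fP.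
- by rewrite inE => /andP[].
- rewrite -fn ?(subsetP AK) //; apply: eq_card => x; rewrite !inE.
  by case: eqP => [->|]; rewrite ?andbF // cA !andbT.
Qed.

Lemma coloring_del f S K n x : x \in S ->
  coloring f S K n -> coloring f (S :\ x) K (fun c => n c - (c == f x)).
Proof.
move=> xS [fP fK fn]; split=> [y z|y|c cK].
- by rewrite !inE => /andP[_ yS] /andP[_ zS]; apply: fP.
- by rewrite inE => /andP[_]; apply: fK.
- have -> : cls f (S :\ x) c = cls f S c :\ x.
    by apply/setP=> y; rewrite !inE; case: eqP.
  by rewrite -fn // [X in _ = X - _](cardsD1 x) inE xS eq_sym; case: eqP; lia.
Qed.

Hypotheses (e_sym : symmetric e) (e_irr : irreflexive e).

Lemma coloring_add f S K n x c : x \notin S -> c \in K ->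
    nbr (cls f S c) x = set0 -> coloring f S K n ->
  coloring (recolor f x c) (x |: S) K (fun d => n d + (d == c)).
Proof.
move=> xS cK xc [fP fK fn].
have fxS y : y \in S -> recolor f x c y = f y.
  by rewrite /recolor; case: eqP => // ->; rewrite (negbTE xS).
have fx : recolor f x c x = c by rewrite /recolor eqxx.
have nc y : y \in S -> e x y -> f y != c.
  move=> yS xy; apply: contraPN xc => yc; apply/eqP/set0Pn.
  by exists y; rewrite !inE yS yc.
split=> [y z|y|d dK].
- case/setU1P=> [->|yS]; case/setU1P=> [->|zS]; rewrite ?e_irr // ?fx ?fxS //.
  + by move=> xz; rewrite eq_sym nc.
  + by rewrite e_sym; apply: nc.
  + exact: fP.
- by case/setU1P=> [->|yS]; rewrite ?fx ?fxS ?fK.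
- rewrite -fn //; case: eqP => [->|/eqP dc].
    rewrite (_ : cls _ _ _ = x |: cls f S c).
      by rewrite cardsU1 inE (negbTE xS) /= addnC.
    apply/setP=> y; rewrite !inE; case: (eqVneq y x) => [->|yx] /=.
      by rewrite fx eqxx.
    by rewrite /recolor (negbTE yx).
  rewrite addn0; apply: eq_card => y; rewrite !inE.
  case: (eqVneq y x) => [->|yx] /=; last by rewrite /recolor (negbTE yx).
  by rewrite fx (negbTE xS) eq_sym (negbTE dc).
Qed.

Lemma coloring_merge f g S B K A n : [disjoint S & B] -> [disjoint K & A] ->
    coloring f S K n -> coloring g B A n ->
  coloring (fun x => if x \in S then f x else g x) (S :|: B) (K :|: A) n.
Proof.
move=> SB KA [fP fK fn] [gP gA gn].
have BnS x : x \in B -> (x \in S) = false.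
  by move=> xB; apply: contraTF xB => /(disjointFr SB) ->.
have fg x y : x \in S -> y \in B -> f x != g y.
  move=> xS yB; apply: contraTneq (gA y yB) => <-.
  by rewrite (disjointFr KA) ?fK.
split=> [x y|x|c].
- case/setUP=> [xS|xB]; case/setUP=> [yS|yB]; rewrite ?xS ?yS ?BnS //.
  + exact: fP.
  + by move=> _; exact: fg.
  + by move=> _; rewrite eq_sym fg.
  + exact: gP.
- by case/setUP=> [xS|xB]; rewrite ?xS ?BnS // inE ?fK // ?gA ?orbT.
- case/setUP=> [cK|cA].
    rewrite -fn //; apply: eq_card => x; rewrite !inE.
    case xS: (x \in S) => //=; case xB: (x \in B) => //=.
    by apply: contraTF cK => /eqP <-; rewrite (disjointFl KA) ?gA.
  rewrite -gn //; apply: eq_card => x; rewrite !inE.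
  case xS: (x \in S) => /=; last by [].
  case xB: (x \in B); first by move: (BnS x xB); rewrite xS.
  by apply: contraTF cA => /eqP <-; rewrite (disjointFr KA) ?fK.
Qed.

Lemma card_by_color f S B K : {in S, forall x, f x \in K} -> B \subset S ->
  #|B| = \sum_(c in K) #|B :&: cls f S c|.
Proof.
move=> fK BS; rewrite -sum1_card (partition_big f (mem K)) /=; last first.
  by move=> x /(subsetP BS)/fK.
apply: eq_bigr => c _; rewrite -sum1_card; apply: eq_bigl => x; rewrite !inE.
by case xB: (x \in B) => //=; rewrite (subsetP BS).
Qed.

Lemma nbr_split f S A x :
  #|nbr S x| = #|nbr [set y in S | f y \notin A] x|
               + \sum_(c in A) #|nbr (cls f S c) x|.
Proof.
rewrite -(cardsID [set y | f y \in A]) addnC; congr (_ + _).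
  by apply: eq_card => y; rewrite !inE; case: (y \in S); rewrite /= ?andbF // andbC.
rewrite -sum1_card (partition_big f (mem A)) /=; last first.
  by move=> y; rewrite !inE => /andP[].
apply: eq_bigr => c cA; rewrite -sum1_card; apply: eq_bigl => y; rewrite !inE.
by case: eqP => [->|]; rewrite ?andbF // cA !andbT.
Qed.

Lemma sum_nbr_swap S B : \sum_(x in S) #|nbr B x| = \sum_(y in B) #|nbr S y|.
Proof.
under eq_bigr do rewrite -sum1_card.
under [RHS]eq_bigr do rewrite -sum1_card.
rewrite (exchange_big_dep (mem B)) /=; last first.
  by move=> x y _; rewrite inE => /andP[].
apply: eq_bigr => y yB; apply: eq_bigl => x; rewrite !inE yB /=.
by rewrite e_sym.
Qed.

Lemma sub_path_targets (T : eqType) (r r' : rel T) x p :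
    (forall y z, y \in x :: p -> z \in p -> r y z -> r' y z) ->
  path r x p -> path r' x p.
Proof.
elim: p x => //= z p IH x rr' /andP[xz zp]; apply/andP; split.
  by apply: rr' => //; rewrite !inE eqxx.
by apply: IH => // y t yp tp; apply: rr'; rewrite inE ?yp ?tp orbT.
Qed.

(** The auxiliary digraph on color classes: an arc means that one vertex of class c can be moved to
    class d. *)
Definition movable f S K c d :=
  [&& c \in K, d \in K, c != d &
      [exists x in cls f S c, nbr (cls f S d) x == set0]].

Lemma shift_path f S K n c p : coloring f S K n ->
    path (movable f S K) c p -> uniq (c :: p) ->
  exists g, [/\ coloring g S K (fun d => n d + (d == last c p) - (d == c)),
    {in S, forall x, f x \notin c :: p -> g x = f x},
    {in S, forall x, f x \in c :: p -> g x \in c :: p}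
  & {in S, forall x, g x = c -> f x = c}].
Proof.
elim: p f n c => [|c1 p IH] f n c colf /=.
  move=> _ _; exists f; split=> //; apply: coloring_ext colf => d _ /=; lia.
case/andP=> /and4P[cK c1K cc1 /exists_inP[x]].
rewrite inE => /andP[xS /eqP fx] /eqP xc1 pth /andP[cp /andP[c1p up]].
have colg : coloring (recolor f x c1) S K (fun d => n d - (d == c) + (d == c1)).
  rewrite -(setD1K xS); apply: coloring_add => //; first by rewrite !inE eqxx.
    rewrite -xc1; apply/setP => y; rewrite !inE; case: eqP => // ->.
    by rewrite e_irr !andbF.
  by rewrite -fx; apply: coloring_del.
have rfx y : y != x -> recolor f x c1 y = f y.
  by rewrite /recolor => /negbTE ->.
have cls_same d : d != c -> d != c1 ->
    cls (recolor f x c1) S d = cls f S d.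
  move=> dc dc1; apply/setP=> y; rewrite !inE /recolor; case: (eqVneq y x) => // ->.
  by rewrite fx ![_ == d]eq_sym (negbTE dc) (negbTE dc1).
have pth1 : path (movable (recolor f x c1) S K) c1 p.
  apply: sub_path_targets pth => d d' dp d'p.
  have dc : d != c by apply: contraNneq cp => <-.
  have d'c : d' != c by apply: contraNneq cp => <-; rewrite inE d'p orbT.
  have d'c1 : d' != c1 by apply: contraNneq c1p => <-.
  case/and4P=> dK d'K dd' /exists_inP[y]; rewrite inE => /andP[yS /eqP fy] yd'.
  apply/and4P; split=> //; apply/exists_inP; exists y; last by rewrite cls_same.
  rewrite inE yS rfx ?fy ?eqxx //; apply: contraNneq dc => yx.
  by rewrite -fy yx fx.
have [g [colh g1 g2 g3]] := IH _ _ _ colg pth1 (introT andP (conj c1p up)).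
exists g; split.
- apply: coloring_ext colh => d dK /=.
  have ncd : d == c -> 0 < n d.
    move=> /eqP ->; case: colf => _ _ <- //.
    by apply/card_gt0P; exists x; rewrite inE xS fx /=.
  apply: addn_bool_cancel => //; apply/negP=> /andP[/eqP -> cE].
  by rewrite eq_sym cE in cc1.
- move=> y yS; rewrite inE negb_or => /andP[yc yp].
  have yx : y != x by apply: contraNneq yc => ->; rewrite fx.
  by rewrite g1 ?rfx.
- move=> y yS yp; rewrite inE.
  have [f1y|f1y] := boolP (recolor f x c1 y \in c1 :: p); first by rewrite g2 ?orbT.
  rewrite g1 //; move: f1y yp; rewrite /recolor; case: eqP => _; first by rewrite inE eqxx.
  by rewrite [f y \in c :: _]inE => /negbTE ->; rewrite orbF => ->.
- move=> y yS gy; have [f1y|f1y] := boolP (recolor f x c1 y \in c1 :: p).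
    by move: (g2 y yS f1y); rewrite gy (negbTE cp).
  move: gy; rewrite g1 // /recolor; case: eqP => // _ cE.
  by move: cc1; rewrite cE eqxx.
Qed.

Definition avoid (r : rel C) z := [rel c d | [&& r c d, c != z & d != z]].

Lemma avoid_path (r : rel C) z c p :
  path r c p -> z \notin c :: p -> path (avoid r z) c p.
Proof.
move=> pth zp; apply: sub_path_targets pth => d d' dp d'p rdd' /=.
apply/and3P; split=> //; first by apply: contraNneq zp => <-.
by apply: contraNneq zp => <-; rewrite inE d'p orbT.
Qed.

Lemma path_avoid (r : rel C) z c p :
  path (avoid r z) c p -> c != z -> z \notin c :: p.
Proof.
elim: p c => [|d p IH] c /=; first by rewrite inE eq_sym.
by case/andP=> /and3P[_ cz dz] /IH zp _; rewrite inE negb_or eq_sym cz zp.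
Qed.

Lemma avoid_sub (r : rel C) z : subrel (avoid r z) r.
Proof. by move=> c d /and3P[]. Qed.

(** A simple path from x to a either misses w, or its part from w onward misses x. *)
Lemma connect_avoid (r : rel C) x w a : x != w -> connect r x a ->
  connect (avoid r w) x a \/ connect (avoid r x) w a.
Proof.
move=> xw /connectP[p0 pth0 ->]; case/shortenP: pth0 => p pth up _.
have [wp|wp] := boolP (w \in p).
  right; move: pth up; case/splitPr: wp => p1 p2; rewrite cat_path /= last_cat /=.
  case/and3P=> _ _ pth; rewrite mem_cat negb_or => /andP[/andP[_ xp2] _].
  by apply/connectP; exists p2 => //; apply: avoid_path.
left; apply/connectP; exists p => //; apply: avoid_path => //.
by rewrite inE negb_or eq_sym xw.
Qed.

(* For a = b this says that f is equitable. *)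
Definition near s f S K a b := coloring f S K (fun c => s + (c == b) - (c == a)).

Definition acc f S K a := [set c in K | connect (movable f S K) c a].

(** * Repairing a coloring with one class too small and one too large *)

Section NearlyEquitable.
Variables (s : nat) (S : {set V}) (K : {set C}) (a b : C) (f : V -> C).
Hypotheses (s_gt0 : 0 < s) (aK : a \in K) (bK : b \in K).
Hypothesis near_f : near s f S K a b.
Hypothesis degS : {in S, forall x, #|nbr S x| < #|K|}.

Let mv := movable f S K.
Let A := acc f S K a.
Let B := [set x in S | f x \notin A].

Hypothesis bA : b \notin A.

Let fP : {in S &, forall x y, e x y -> f x != f y}. Proof. by case: near_f. Qed.
Let fK : {in S, forall x, f x \in K}. Proof. by case: near_f. Qed.
Let fn : {in K, forall c, #|cls f S c| = s + (c == b) - (c == a)}.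
Proof. by case: near_f. Qed.

Lemma acc_sub : A \subset K.
Proof. by apply/subsetP=> c; rewrite inE => /andP[]. Qed.

Lemma acc_target : a \in A.
Proof. by rewrite inE aK connect0. Qed.

Lemma acc_closed c d : mv c d -> d \in A -> c \in A.
Proof.
move=> cd; rewrite !inE => /andP[_ da]; case/and4P: (cd) => -> _ _ _ /=.
exact: connect_trans (connect1 cd) da.
Qed.

Lemma nbr_pos x c : x \in S -> c \in K -> f x != c -> ~~ mv (f x) c ->
  0 < #|nbr (cls f S c) x|.
Proof.
move=> xS cK xc; apply: contraR; rewrite -eqn0Ngt cards_eq0 => xc0.
by apply/and4P; split=> //; [apply: fK|apply/exists_inP; exists x; rewrite ?inE ?xS /=].
Qed.

(** Otherwise y could move to c, which would make its own class accessible. *)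
Lemma nbr_acc y c : y \in B -> c \in A -> 0 < #|nbr (cls f S c) y|.
Proof.
rewrite inE => /andP[yS yA] cA; apply: nbr_pos => //.
- exact: subsetP acc_sub _ cA.
- by apply: contraNneq yA => ->.
- by apply: contraNN yA => yc; apply: acc_closed yc cA.
Qed.

Lemma degB y : y \in B -> #|nbr B y| + #|A| < #|K|.
Proof.
move=> yB; have yS : y \in S by move: yB; rewrite inE => /andP[].
apply: leq_ltn_trans (degS yS); rewrite (nbr_split f S A) leq_add2l -sum1_card.
by apply: leq_sum => c cA; apply: nbr_acc.
Qed.

Lemma card_acc_lt : #|A| < #|K|.
Proof.
by apply/proper_card/properP; split; [apply: acc_sub|exists b].
Qed.

Lemma inB x : (x \in B) = (x \in S) && (f x \notin A).
Proof. by rewrite inE. Qed.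

Lemma cls_B c : c \notin A -> B :&: cls f S c = cls f S c.
Proof.
move=> cA; apply/setP=> x; rewrite in_setI inB [x \in cls _ _ _]inE.
by case: eqP => [->|_]; rewrite ?andbF // cA !andbT andbb.
Qed.

Lemma cardB : #|B| = s * (#|K| - #|A|) + 1.
Proof.
have BS : B \subset S by apply/subsetP=> x; rewrite inB => /andP[].
rewrite (card_by_color fK BS) (bigID (mem A)) /= big1 => [|c /andP[_ cA]].
  have ab : (b == a) = false by apply: contraNF bA => /eqP ->; apply: acc_target.
  rewrite add0n.
  rewrite (eq_bigr (fun c => s + (c == b))) => [|c /andP[cK cA]]; last first.
    rewrite cls_B // fn //; case: (c =P a) cA => [->|_ _]; first by rewrite acc_target.
    by rewrite subn0.
  rewrite big_split /= sum_nat_const; congr (_ + _).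
    rewrite mulnC -cardsDS ?acc_sub //; congr (_ * _).
    by apply: eq_card => c; rewrite in_setD andbC.
  rewrite (bigD1 b) /= ?bK ?bA // eqxx big1 // => c /andP[_].
  by case: eqP.
apply/eqP; rewrite cards_eq0; apply/eqP/setP=> x.
rewrite in_setI inB in_set0 [x \in cls _ _ _]inE.
by case: eqP => [->|_]; rewrite ?andbF // cA !andbF.
Qed.

(* Kierstead and Kostochka's choice: the classes of T are those cut off from
   the small class a by deleting U, where U makes this set minimal. *)
Lemma terminal_classes : 1 < #|A| -> exists U (T : {set C}),
  [/\ T \subset A, T != set0, a \notin T, U \in A & U \notin T] /\
  [/\ {in T & A, forall W X, X != W -> connect (avoid mv W) X a}
    & {in T & A, forall W X, X \notin T -> X != U -> ~~ mv W X}].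
Proof.
move=> A1; pose T U := [set c in A | (c != U) && ~~ connect (avoid mv U) c a].
have accC c : c \in A -> connect mv c a by rewrite inE => /andP[].
(* Deleting [a] itself cuts off every other accessible class, so the minimum is over a nonempty
   family. *)
have Ta : T a != set0.
  have [c cA ca] : exists2 c, c \in A & c != a.
    have : 0 < #|A :\ a| by move: A1; rewrite (cardsD1 a A) acc_target.
    by case/card_gt0P=> c /setD1P[]; exists c.
  apply/set0Pn; exists c; rewrite [_ \in T _]inE cA ca /=.
  apply/negP=> /connectP[p pth ap].
  by have := path_avoid pth ca; rewrite ap mem_last.
pose P := [pred U in A | T U != set0].
have PA : P a by rewrite /= acc_target.
case: (arg_minnP (fun U => #|T U|) PA) => U /andP[/= UA TU0] Umin.
have TcutU W X : W \in T U -> X \in A -> X != U -> X \notin T U ->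
    connect (avoid mv U) X a.
  by move=> _ XA XU; rewrite [_ \in T _]inE XA XU /= negbK.
(* A class not cut off by U is not cut off by W either: a path from it to [a] through W would
   contain a path from W to [a] avoiding U. *)
have TW W X : W \in T U -> X \in A -> X \notin T U -> X \notin T W.
  move=> WT XA XT; rewrite [_ \in T _]inE negb_and XA /= negb_and !negbK orbC.
  have := WT; rewrite [_ \in T _]inE => /and3P[WA WU Wa].
  have XW : X != W by apply: contraNneq XT => ->.
  case: (eqVneq X U) => [XU|XU].
    rewrite XU in XW *.
    case: (connect_avoid XW (accC _ UA)) => [-> //|].
    by rewrite (negbTE Wa).
  have := TcutU W X WT XA XU XT => cXa.
  case: (connect_avoid XW cXa) => [cX|cW].
    apply/orP; left; apply: connect_sub cX => x y /and3P[/and3P[xy _ _] xW yW].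
    by apply: connect1; apply/and3P.
  case/negP: Wa; apply: connect_sub cW => x y /and3P[xy _ _].
  exact: connect1.
(* T W lies in T U and misses W, so it is strictly smaller, and minimality of U forces it to be
   empty. *)
have TW0 W : W \in T U -> T W = set0.
  move=> WT; apply/eqP; apply/negPn/negP => TW0.
  have WA : W \in A by move: WT; rewrite [_ \in T _]inE => /andP[].
  have := Umin W; rewrite /P /= WA TW0 leqNgt => /(_ isT)/negP; apply.
  apply/proper_card/properP; split.
    apply/subsetP=> X XTW; have XA : X \in A.
      by move: XTW; rewrite [_ \in T _]inE => /andP[].
    by apply: contraLR XTW; apply: TW.
  by exists W => //; rewrite [_ \in T _]inE eqxx /= andbF.
exists U, (T U); split; split=> //.
- by apply/subsetP=> c; rewrite [_ \in T _]inE => /andP[].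
- by rewrite [_ \in T _]inE connect0 !andbF.
- by rewrite [_ \in T _]inE eqxx /= andbF.
- move=> W X WT XA XW.
  by move/setP/(_ X): (TW0 W WT); rewrite [_ \in T _]inE in_set0 XA XW /= => /negbFE.
- move=> W X WT XA XT XU; have cX := TcutU W X WT XA XU XT.
  move: WT; rewrite [_ \in T _]inE => /and3P[WA WU]; apply: contraNN => WX.
  by apply: connect_trans (connect1 _) cX; apply/and3P.
Qed.

Lemma deg_blocked (D : {set C}) z : z \in S -> D \subset A ->
  {in D, forall c, nbr (cls f S c) z != set0} -> #|nbr B z| + #|D| < #|K|.
Proof.
move=> zS DA zD; apply: leq_ltn_trans (degS zS); rewrite (nbr_split f S A).
rewrite leq_add2l -sum1_card (bigID (mem D) (mem A)) /= -[X in X <= _]addn0.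
apply: leq_add => //; rewrite [X in _ <= X](eq_bigl (mem D)) => [|c /=].
  by apply: leq_sum => c cD; rewrite card_gt0 zD.
by apply/andP/idP => [[]//|cD]; rewrite (subsetP DA).
Qed.

(** If only [a] were accessible, each of the s (#|K| - 1) + 1 vertices of B would have a neighbor in
    class [a], whose s - 1 vertices have at most #|K| - 1 neighbors each. *)
Lemma acc_gt1 : 1 < #|A|.
Proof.
rewrite ltnNge; apply/negP=> A1.
have Aa : A = [set a].
  apply/eqP; rewrite eq_sym eqEcard sub1set acc_target cards1.
  exact: A1.
have aB : a != b by apply: contraNneq bA => <-; apply: acc_target.
have : #|B| <= \sum_(y in B) #|nbr (cls f S a) y|.
  by rewrite -sum1_card; apply: leq_sum => y yB; apply: nbr_acc => //; apply: acc_target.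
rewrite sum_nbr_swap cardB Aa cards1.
have : \sum_(x in cls f S a) #|nbr B x| <= (s - 1) * (#|K| - 1).
  have <- : #|cls f S a| = s - 1 by rewrite fn // eqxx (negbTE aB) addn0.
  rewrite -sum_nat_const; apply: leq_sum => x; rewrite inE => /andP[xS _].
  have : #|nbr B x| + #|@set0 C| < #|K|.
    by apply: deg_blocked; rewrite ?sub0set // => c; rewrite inE.
  by rewrite cards0; clear; lia.
by move=> H1 H2; have := leq_trans H2 H1; rewrite mulnBl; nia.
Qed.

Lemma acc_path c p : path mv c p -> last c p = a -> {subset c :: p <= A}.
Proof.
elim: p c => [|d p IH] c /=; first by move=> _ -> x; rewrite inE => /eqP ->; apply: acc_target.
case/andP=> cd /IH{}IH /IH{}IH x; rewrite inE => /predU1P[->|/IH //].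
by apply: acc_closed cd _; apply: IH; rewrite mem_head.
Qed.

Hypothesis IHcol : forall S' K', #|K'| < #|K| -> K' != set0 ->
  #|S'| = s * #|K'| -> {in S', forall x, #|nbr S' x| < #|K'|} ->
  exists g, coloring g S' K' (fun=> s).

(** The surplus vertex lies in B, so removing any y from B leaves a multiple of s; by [degB] the
    degrees inside B are below the number of remaining colors. *)
Lemma color_B y : y \in B -> exists g, coloring g (B :\ y) (K :\: A) (fun=> s).
Proof.
move=> yB; have KA : #|K :\: A| = #|K| - #|A| by rewrite cardsDS ?acc_sub.
have ltA := card_acc_lt; have A1 := acc_gt1.
apply: IHcol; rewrite ?KA.
- by lia.
- by rewrite -card_gt0 KA subn_gt0.
- by have := cardB; rewrite (cardsD1 y) yB; lia.
- move=> x; rewrite in_setD1 => /andP[_ xB]; have := degB xB.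
  have : #|nbr (B :\ y) x| <= #|nbr B x|.
    by apply/subset_leq_card/subsetP=> u; rewrite !in_set in_set1 => /andP[/andP[_ ->]].
  lia.
Qed.

(** Moving z out of its class makes room there for y. *)
Definition solo (T : {set C}) z y :=
  [&& z \in S, f z \in T, y \in B & nbr (cls f S (f z)) y == [set z]].

Section Terminal.
Variables (U : C) (T : {set C}).
Hypotheses (TA : T \subset A) (aT : a \notin T) (UA : U \in A) (UT : U \notin T).
Hypothesis T_term : {in T & A, forall W X, X != W -> connect (avoid mv W) X a}.
Hypothesis T_out :
  {in T & A, forall W X, X \notin T -> X != U -> ~~ mv W X}.

Lemma bT : b \notin T.
Proof. by apply: contraNN bA; apply: (subsetP TA). Qed.

(** Shift along a path from c to [a] that avoids W, move z to c and put y in place of z. This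
    balances all accessible classes, and [color_B] colors the rest of B. Terminality of W supplies
    the path, so W is untouched by the shift, while c only loses a vertex and stays open to z. *)
Lemma solo_movable z y c : solo T z y -> c \in A -> c != f z ->
  nbr (cls f S c) z = set0 -> exists g, coloring g S K (fun=> s).
Proof.
set W := f z => /and4P[zS WT yB /eqP yz] cA cW zc.
have yS : y \in S by move: yB; rewrite inB => /andP[].
have WA : W \in A by apply: (subsetP TA).
case/connectP: (T_term WT cA cW) => p0 pth0; case/shortenP: pth0 => p pthW up _ la.
have pth : path mv c p by apply: sub_path pthW; apply: avoid_sub.
have pA := acc_path pth (esym la).
have Wp : W \notin c :: p by apply: path_avoid pthW cW.
have [g [colg g1 g2 g3]] := shift_path near_f pth up.
rewrite -la in colg.
have gW u : u \in S -> g u = W -> f u = W.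
  move=> uS gu; rewrite -(g1 u uS) //; apply: contraNN Wp => fu.
  by rewrite -gu; apply: g2.
have gA u : u \in S -> (g u \in A) = (f u \in A).
  move=> uS; have [fu|fu] := boolP (f u \in c :: p); last by rewrite g1.
  by rewrite !pA ?g2.
have gz : g z = W by rewrite g1.
pose SA := [set x in S | g x \in A].
have zSA : z \in SA by rewrite inE zS gz.
have ySA : y \notin SA :\ z.
  by rewrite in_setD1 inE yS gA //=; move: yB; rewrite inB yS => /negbTE ->; rewrite andbF.
have yz' : y != z by apply: contraTneq yB => ->; rewrite inB WA andbF.
have col1 := coloring_del zSA (coloring_restrict acc_sub colg).
have yW0 : nbr (cls g (SA :\ z) W) y = set0.
  apply/eqP/set0Pn => -[u].
  rewrite [u \in nbr _ _]inE [u \in cls _ _ _]inE in_setD1 [u \in SA]inE.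
  case/andP=> /andP[/and3P[uz uS _] /eqP gu] yu.
  have : u \in nbr (cls f S W) y by rewrite !inE uS gW // eqxx.
  by rewrite yz inE (negbTE uz).
have col2 := coloring_add ySA WA yW0 col1.
have zSA' : z \notin y |: SA :\ z.
  by rewrite in_setU1 negb_or eq_sym yz' in_setD1 eqxx.
have zc0 : nbr (cls (recolor g y W) (y |: SA :\ z) c) z = set0.
  apply/eqP/set0Pn => -[u].
  rewrite [u \in nbr _ _]inE [u \in cls _ _ _]inE in_setU1 in_setD1 [u \in SA]inE.
  rewrite {1}/recolor; case: (eqVneq u y) => [_|uy] /=.
    by rewrite eq_sym (negbTE cW).
  case/andP=> /andP[/and3P[uz uS _] /eqP gu] zu.
  have : u \in nbr (cls f S c) z by rewrite !inE uS g3 // eqxx.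
  by rewrite zc inE.
have col3 := coloring_add zSA' cA zc0 col2.
have [g4 col4] := color_B yB.
have Wa : W != a by apply: contraNneq aT => <-.
have Wb : W != b by apply: contraNneq bT => <-.
have {}col3 : coloring (recolor (recolor g y W) z c) (z |: (y |: SA :\ z)) A (fun=> s).
  apply: coloring_ext col3 => d dA /=; rewrite gz.
  have -> : (d == b) = false by apply: contraNF bA => /eqP <-.
  rewrite addn0 -!addnA subnK; last by case: (d == a).
  case: (d =P W) => [->|_]; first by rewrite [W == c]eq_sym (negbTE cW) /= addn0 subn0 subnK.
  by rewrite subn0 subnK //; case: (d == c).
have SE : (z |: (y |: SA :\ z)) :|: (B :\ y) = S.
  apply/setP=> u; rewrite in_setU in_setD1 !in_setU1 in_setD1 [u \in SA]inE inB.
  case: (eqVneq u z) => [->|_]; first by rewrite zS.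
  case: (eqVneq u y) => [->|_]; first by rewrite yS.
  rewrite /=; case uS: (u \in S) => //=; rewrite gA //.
  by case: (f u \in A).
have KE : A :|: (K :\: A) = K.
  apply/setP=> d; rewrite in_setU in_setD; case dA: (d \in A) => //=.
  by rewrite (subsetP acc_sub).
have dSB : [disjoint z |: (y |: SA :\ z) & B :\ y].
  rewrite disjoint_sym disjoints_subset; apply/subsetP=> u.
  rewrite in_setD1 in_setC !in_setU1 in_setD1 [u \in SA]inE inB => /and3P[uy uS uA].
  rewrite (negbTE uy) gA // (negbTE uA) !andbF !orbF.
  by apply: contraNneq uA => ->.
have dAK : [disjoint A & K :\: A].
  by rewrite disjoint_sym disjoints_subset; apply/subsetP=> d; rewrite in_setD in_setC => /andP[].
have := coloring_merge dSB dAK col3 col4; rewrite SE KE => colS.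
by eexists; apply: colS.
Qed.

(** Here z has no place in the other accessible classes. It moves into a recolored class of B and y1
    replaces it in W. Now y2 has lost its only neighbor in W and is not adjacent to y1, so the class
    of y2 becomes accessible in addition to the old ones. *)
Lemma solo_swap z y1 y2 : solo T z y1 -> solo T z y2 -> y1 != y2 -> ~~ e y1 y2 ->
    {in A, forall c, c != f z -> nbr (cls f S c) z != set0} ->
  exists g b', [/\ b' \in K, near s g S K a b' & #|A| < #|acc g S K a|].
Proof.
set W := f z => /and4P[zS WT y1B /eqP y1z] /and4P[_ _ y2B /eqP y2z] y12 ney12 zA.
have WA : W \in A by apply: (subsetP TA).
have Wa : W != a by apply: contraNneq aT => <-.
have Wb : W != b by apply: contraNneq bT => <-.
have y1S : y1 \in S by move: y1B; rewrite inB => /andP[].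
have y2S : y2 \in S by move: y2B; rewrite inB => /andP[].
have zB : z \notin B by rewrite inB WA andbF.
have y1z' : y1 != z by apply: contraNneq zB => <-.
have y2z' : y2 != z by apply: contraNneq zB => <-.
have [h colh] := color_B y1B.
(* Pigeonhole: z has a neighbor in each of #|A| - 1 accessible classes and y1 is one of its
   neighbors in B, which leaves fewer than #|K :\: A| neighbors in B :\ y1. *)
have [Y YKA zY] : exists2 Y, Y \in K :\: A & nbr (cls h (B :\ y1) Y) z = set0.
  have zdeg : #|nbr B z| + #|A :\ W| < #|K|.
    apply: deg_blocked => //; first exact: subsetDl.
    by move=> c; rewrite in_setD1 => /andP[cW cA]; apply: zA.
  have zy1 : y1 \in nbr B z.
    rewrite inE y1B e_sym; have : z \in nbr (cls f S W) y1 by rewrite y1z inE.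
    by rewrite inE => /andP[].
  have ltd : #|nbr (B :\ y1) z| < #|K :\: A|.
    rewrite cardsDS ?acc_sub //.
    rewrite (cardsD1 W A) WA in zdeg *; rewrite (cardsD1 y1) zy1 in zdeg.
    have -> : nbr (B :\ y1) z = nbr B z :\ y1.
      by apply/setP=> u; rewrite in_setD1 ![u \in nbr _ _]inE in_setD1 andbA.
    by move: zdeg; clear; rewrite /=; lia.
  case: (pickP [pred Y in K :\: A | nbr (cls h (B :\ y1) Y) z == set0]).
    by move=> Y /andP[YK /eqP Y0]; exists Y.
  move=> noY.
  move: ltd; rewrite ltnNge (nbr_split h _ (K :\: A)) -sum1_card => /negP[].
  apply: leq_trans (leq_addl _ _); apply: leq_sum => Y YK.
  by rewrite card_gt0; have := noY Y; rewrite inE /= YK /= => ->.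
pose SA := [set x in S | f x \in A].
have zSA : z \in SA by rewrite inE zS.
have y1SA : y1 \notin SA :\ z.
  by rewrite in_setD1 inE y1S /=; move: y1B; rewrite inB y1S => /negbTE ->; rewrite andbF.
have yW0 : nbr (cls f (SA :\ z) W) y1 = set0.
  apply/eqP/set0Pn => -[u].
  rewrite [u \in nbr _ _]inE [u \in cls _ _ _]inE in_setD1 [u \in SA]inE.
  case/andP=> /andP[/and3P[uz uS _] /eqP fu] yu.
  have : u \in nbr (cls f S W) y1 by rewrite !inE uS fu eqxx.
  by rewrite y1z inE (negbTE uz).
have col1 := coloring_add y1SA WA yW0
  (coloring_del zSA (coloring_restrict acc_sub near_f)).
have zB1 : z \notin B :\ y1 by rewrite in_setD1 (negbTE zB) andbF.
have col2 := coloring_add zB1 YKA zY colh.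
have dAK : [disjoint A & K :\: A].
  by rewrite disjoint_sym disjoints_subset; apply/subsetP=> d; rewrite in_setD in_setC => /andP[].
set n : C -> nat := fun c => s + (c == Y) - (c == a).
have YA : Y \notin A by move: YKA; rewrite in_setD => /andP[].
have YK : Y \in K by move: YKA; rewrite in_setD => /andP[].
have {}col1 : coloring (recolor f y1 W) (y1 |: SA :\ z) A n.
  apply: coloring_ext col1 => d dA; rewrite /n -/W.
  have -> : (d == b) = false by apply: contraNF bA => /eqP <-.
  have -> : (d == Y) = false by apply: contraNF YA => /eqP <-.
  rewrite addn0; case: (d =P W) => [->|_]; last by rewrite subn0 addn0.
  by rewrite (negbTE Wa) subn0 subnK.
have {}col2 : coloring (recolor h z Y) (z |: B :\ y1) (K :\: A) n.
  apply: coloring_ext col2 => d; rewrite in_setD => /andP[dA _]; rewrite /n.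
  have -> : (d == a) = false by apply: contraNF dA => /eqP ->; apply: acc_target.
  by rewrite subn0.
have dSB : [disjoint y1 |: SA :\ z & z |: B :\ y1].
  rewrite disjoints_subset; apply/subsetP=> u.
  rewrite in_setC !in_setU1 !in_setD1 [u \in SA]inE inB negb_or negb_and negbK.
  case/predU1P=> [->|/and3P[uz uS uA]]; first by rewrite y1z' eqxx.
  by rewrite uz uA uS !orbT.
have SE : (y1 |: SA :\ z) :|: (z |: B :\ y1) = S.
  apply/setP=> u; rewrite in_setU !in_setU1 !in_setD1 [u \in SA]inE inB.
  case: (eqVneq u z) => [->|_]; first by rewrite zS orbT.
  case: (eqVneq u y1) => [->|_]; first by rewrite y1S.
  by rewrite /=; case: (u \in S) => //=; case: (f u \in A).
have KE : A :|: (K :\: A) = K.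
  apply/setP=> d; rewrite in_setU in_setD; case dA: (d \in A) => //=.
  by rewrite (subsetP acc_sub).
have := coloring_merge dSB dAK col1 col2; rewrite SE KE.
set g := (fun x => _) => colg.
have g_y1 : g y1 = W by rewrite /g in_setU1 eqxx /recolor eqxx.
have g_z : g z = Y.
  by rewrite /g in_setU1 eq_sym (negbTE y1z') in_setD1 eqxx /= /recolor eqxx.
have g_A u : u \in S -> f u \in A -> u != z -> g u = f u.
  move=> uS uA uz; rewrite /g in_setU1 in_setD1 uz [u \in SA]inE uS uA orbT.
  rewrite /recolor; case: eqP => // uy1.
  by move: y1B; rewrite inB -uy1 uA andbF.
have g_B u : u \in B -> u != y1 -> g u = h u /\ g u \in K :\: A.
  move=> uB uy; have uz : u != z by apply: contraNneq zB => <-.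
  have -> : g u = h u.
    rewrite /g in_setU1 (negbTE uy) in_setD1 uz [u \in SA]inE.
    by move: uB; rewrite inB => /andP[_ /negbTE ->]; rewrite andbF /recolor (negbTE uz).
  by split=> //; case: colh => _ hK _; apply: hK; rewrite in_setD1 uy.
have g_inv u d : u \in S -> d \in A -> g u = d -> u = y1 \/ u != z /\ f u = d.
  move=> uS dA gu; case: (eqVneq u y1) => [|uy]; [by left|right].
  have uz : u != z by apply: contraTneq dA => uz; rewrite -gu uz g_z.
  split=> //; rewrite -gu g_A //; apply: contraTT dA => uA.
  have uB : u \in B by rewrite inB uS.
  by have [_] := g_B u uB uy; rewrite gu in_setD => /andP[].
have clsE d : d \in A -> d != W -> cls g S d = cls f S d.
  move=> dA dW; apply/setP=> u; rewrite ![u \in cls _ _ _]inE.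
  case uS: (u \in S) => //=; apply/eqP/eqP => [gu|fu].
    by case: (g_inv u d uS dA gu) => [uy|[]//]; rewrite -gu uy g_y1 eqxx in dW.
  have uz : u != z by apply: contraNneq dW => uz; rewrite -fu uz.
  by rewrite g_A ?fu.
have reach p c : path (avoid mv W) c p -> last c p = a -> c != W ->
    connect (movable g S K) c a.
  elim: p c => [|d p IHp] c /=; first by move=> _ -> _.
  move=> /andP[/and3P[cd cW dW] pth] la _; apply: connect_trans (IHp d pth la dW).
  apply: connect1; have pA := acc_path (sub_path (@avoid_sub mv W) pth) la.
  have dA : d \in A by apply: pA; rewrite mem_head.
  have cA : c \in A by apply: acc_closed cd dA.
  by move: cd; rewrite /mv /movable !clsE.
have accW c : c \in A -> c != W -> connect (movable g S K) c a.
  by move=> cA cW; case/connectP: (T_term WT cA cW) => p pth /esym la; apply: reach pth la cW.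
have WK : W \in K by apply: (subsetP acc_sub).
(* The vertex of W realizing the first arc is not z, which is blocked, so it is still in W; the path
   can then be continued avoiding W. *)
have WW : connect (movable g S K) W a.
  have : connect mv W a by move: WA; rewrite inE => /andP[].
  case/connectP=> -[|X p] /=; first by move=> _ aW; rewrite aW eqxx in Wa.
  case/andP=> WX pth /esym la.
  have XA : X \in A by apply: (acc_path pth la); rewrite mem_head.
  case/and4P: (WX) => _ XK WneX /exists_inP[w]; rewrite inE => /andP[wS /eqP fw] wX.
  have XW : X != W by rewrite eq_sym.
  apply: connect_trans (accW X XA XW); apply: connect1.
  apply/and4P; split=> //; apply/exists_inP; exists w; last by rewrite clsE.
  rewrite inE wS g_A ?fw //= ; apply: contraTneq wX => ->; exact: zA.
have [gy2 gy2K] := g_B y2 y2B (negbT (introF eqP (fun E => negP y12 (introT eqP (esym E))))).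
have y2A : g y2 \notin A by move: gy2K; rewrite in_setD => /andP[].
have acc_y2 : connect (movable g S K) (g y2) a.
  apply: connect_trans WW; apply: connect1; apply/and4P; split=> //.
  - by move: gy2K; rewrite in_setD => /andP[].
  - by apply: contraNneq y2A => ->.
  - apply/exists_inP; exists y2; first by rewrite inE y2S /=.
    apply/set0Pn => -[u]; rewrite [u \in nbr _ _]inE [u \in cls _ _ _]inE.
    case/andP=> /andP[uS /eqP gu] y2u.
    case: (g_inv u W uS WA gu) => [uy|[uz fu]].
      by move: ney12; rewrite e_sym -uy y2u.
    have : u \in nbr (cls f S W) y2 by rewrite !inE uS fu eqxx.
    by rewrite y2z inE (negbTE uz).
exists g, Y; split=> //.
apply: (@leq_trans #|g y2 |: A|); first by rewrite cardsU1 y2A.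
apply/subset_leq_card/subsetP=> d /setU1P[->|dA]; rewrite inE.
  by rewrite acc_y2 andbT; move: gy2K; rewrite in_setD => /andP[].
rewrite (subsetP acc_sub) //=; case: (eqVneq d W) => [->//|]; exact: accW.
Qed.

Hypothesis solo_blocked : forall z y, solo T z y ->
  {in A, forall c, c != f z -> nbr (cls f S c) z != set0}.

(** By [T_out], z has a neighbor in every accessible class outside U |: T; the extra 1 for U is
    absorbed by the strict degree bound. *)
Lemma deg_terminal z : z \in S -> f z \in T -> #|nbr B z| + #|A| <= #|K| + #|T|.
Proof.
move=> zS zT; have UTA : U |: T \subset A by rewrite subUset sub1set UA.
have : #|nbr B z| + #|A :\: (U |: T)| < #|K|.
  apply: deg_blocked => //; first exact: subsetDl.
  move=> c; rewrite in_setD in_setU1 negb_or => /andP[/andP[cU cT] cA].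
  rewrite -card_gt0; apply: nbr_pos => //; first exact: subsetP acc_sub _ cA.
    by apply: contraNneq cT => <-.
  exact: T_out.
rewrite cardsDS // cardsU1 UT; have := subset_leq_card UTA; rewrite cardsU1 UT.
by clear; lia.
Qed.

Lemma deg_solo z y : solo T z y -> #|nbr B z| + #|A| <= #|K|.
Proof.
move=> zy; case/and4P: (zy) => zS zT _ _.
have : #|nbr B z| + #|A :\ f z| < #|K|.
  apply: deg_blocked => //; first exact: subsetDl.
  by move=> c; rewrite in_setD1 => /andP[cz cA]; apply: solo_blocked zy c cA cz.
by rewrite [in X in _ -> X](cardsD1 (f z) A) (subsetP TA) //; clear; lia.
Qed.

Lemma card_cls_T W : W \in T -> #|cls f S W| = s.
Proof.
move=> WT; rewrite fn ?(subsetP acc_sub) ?(subsetP TA) //.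
have -> : (W == b) = false by apply: contraTF WT => /eqP ->; apply: bT.
have -> : (W == a) = false by apply: contraTF WT => /eqP ->.
by rewrite addn0 subn0.
Qed.

(* A vertex of B has two neighbours in the class W, or one that is solo and
   hence has few neighbours in B. *)
Lemma card_terminal_gt : T != set0 -> #|K| - #|A| < #|T|.
Proof.
case/set0Pn=> W WT; pose Sol := [set z in cls f S W | [exists y, solo T z y]].
pose D := cls f S W :\: Sol.
have SolW : Sol \subset cls f S W by apply/subsetP=> z; rewrite inE => /andP[].
have cSD : #|Sol| + #|D| = s.
  by rewrite -(card_cls_T WT) -(cardsID Sol (cls f S W)) (setIidPr SolW).
(* Counting solo vertices twice gives every y weight at least 2. Summing over B and bounding the
   degrees into B by #|K| - #|A| on Sol, and by #|T| more on D, leaves #|K| - #|A| < #|T|. *)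
have wgt y : y \in B -> 2 <= 2 * #|nbr Sol y| + #|nbr D y|.
  move=> yB; have nS : nbr (cls f S W) y :&: Sol = nbr Sol y.
    apply/setP=> z; rewrite in_setI ![z \in nbr _ _]inE andbC andbA.
    by congr (_ && _); case zSol: (z \in Sol) => //=; rewrite (subsetP SolW).
  have nD : nbr (cls f S W) y :\: Sol = nbr D y.
    by apply/setP=> z; rewrite in_setD ![z \in nbr _ _]inE in_setD andbA.
  have := nbr_acc yB (subsetP TA W WT); rewrite -(cardsID Sol) nS nD.
  case: (posnP #|nbr Sol y|) => [Sol0|]; last by clear; lia.
  rewrite Sol0 /= leq_eqVlt => /predU1P[D1|]; last by clear; lia.
  have /cards1P[z yz] : #|nbr (cls f S W) y| == 1.
    by rewrite -(cardsID Sol) nS nD Sol0 -D1.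
  have zW : z \in nbr (cls f S W) y by rewrite yz inE.
  move: zW; rewrite inE [z \in cls _ _ _]inE => /andP[/andP[zS /eqP fz] yz'].
  have : z \in nbr Sol y.
    rewrite inE yz' andbT [z \in Sol]inE [z \in cls _ _ _]inE zS fz eqxx /=.
    by apply/existsP; exists y; rewrite /solo zS fz WT yB yz eqxx.
  by move/eqP: Sol0; rewrite cards_eq0 => /eqP ->; rewrite inE.
have sumW : #|B| * 2 <= \sum_(y in B) (2 * #|nbr Sol y| + #|nbr D y|).
  by rewrite -sum_nat_const; apply: leq_sum.
move: sumW; rewrite big_split /= -big_distrr /= sum_nbr_swap [X in _ + X]sum_nbr_swap.
have s1 : \sum_(z in Sol) #|nbr B z| <= #|Sol| * (#|K| - #|A|).
  rewrite -sum_nat_const; apply: leq_sum => z; rewrite inE => /andP[_ /existsP[y zy]].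
  by have := deg_solo zy; clear; lia.
have s2 : \sum_(z in D) #|nbr B z| <= #|D| * (#|K| - #|A| + #|T|).
  rewrite -sum_nat_const; apply: leq_sum => z; rewrite in_setD => /andP[_].
  rewrite inE => /andP[zS /eqP fz].
  by have := @deg_terminal z zS; rewrite fz => /(_ WT); have := card_acc_lt; clear; lia.
have := cardB; move: s1 s2 cSD; move: #|Sol| #|D| (#|K| - #|A|) #|T| #|B|; clear.
move: (\sum_(_ in _) _) (\sum_(_ in _) _) => X Y x d k t m h1 h2 <- ->.
by nia.
Qed.

(** Outside B, y has a neighbor in each accessible class, and a second one in each terminal class
    where it has no solo neighbor; its degree bound thus forces many solo neighbors. *)
Lemma card_solo y : y \in B ->
  #|T| + #|nbr B y| < #|[set z | solo T z y]| + (#|K| - #|A|).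
Proof.
move=> yB; have yS : y \in S by move: yB; rewrite inB => /andP[].
pose T1 := [set c in T | #|nbr (cls f S c) y| == 1].
have T1le : #|T1| <= #|[set z | solo T z y]|.
  apply: leq_trans (leq_imset_card f _); apply/subset_leq_card/subsetP=> c.
  rewrite inE => /andP[cT /cards1P[z yz]].
  have : z \in nbr (cls f S c) y by rewrite yz inE.
  rewrite inE [z \in cls _ _ _]inE => /andP[/andP[zS /eqP fz] _].
  by apply/imsetP; exists z; rewrite // inE /solo zS fz cT yB yz eqxx.
have T1T : T1 \subset T by apply/subsetP=> c; rewrite inE => /andP[].
have : #|A| + #|T :\: T1| <= \sum_(c in A) #|nbr (cls f S c) y|.
  have -> : #|T :\: T1| = \sum_(c in A) (c \in T :\: T1).
    rewrite -sum1_card big_mkcond [RHS]big_mkcond; apply: eq_bigr => c _.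
    case: ifP => [cD|cD]; last by rewrite if_same.
    by rewrite (subsetP TA) //; move: cD; rewrite in_setD => /andP[].
  rewrite -sum1_card -big_split; apply: leq_sum => c cA /=.
  have := nbr_acc yB cA; rewrite in_setD [c \in T1]inE.
  by case: (c \in T); rewrite /= ?andbF ?andbT; case: #|_| => [|[|m]].
have := degS yS; rewrite (nbr_split f S A) cardsDS //.
have := subset_leq_card T1T; move: T1le; have := card_acc_lt.
rewrite -/B; clear; lia.
Qed.

(** Otherwise the solo neighbors of each z form a clique, so N z is at most one more than the degree
    in B of any of them. Let each z spread a unit evenly over its solo neighbors: at most s #|T| is
    given out, but each y in B receives at least #|T| / (#|K| - #|A|), which is too much since #|B|
    exceeds s (#|K| - #|A|). *)
Lemma solo_pair : T != set0 ->
  exists z y1 y2, [/\ solo T z y1, solo T z y2, y1 != y2 & ~~ e y1 y2].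
Proof.
move=> T0.
case: (boolP [exists p : V * (V * V), [&& solo T p.1 p.2.1, solo T p.1 p.2.2,
    p.2.1 != p.2.2 & ~~ e p.2.1 p.2.2]]) => [/existsP[[z [y1 y2]] /= /and4P[]]|].
  by exists z, y1, y2.
rewrite negb_exists => /forallP noP; exfalso.
have e_solo z y1 y2 : solo T z y1 -> solo T z y2 -> y1 != y2 -> e y1 y2.
  move=> h1 h2 h3; have := noP (z, (y1, y2)).
  by rewrite /= h1 h2 h3 /= negbK.
pose N z := #|[set y | solo T z y]|.
have N_le z y : solo T z y -> N z <= #|nbr B y|.+1.
  move=> zy; have yN : y \in [set y | solo T z y] by rewrite inE.
  rewrite /N (cardsD1 y) yN ltnS; apply/subset_leq_card/subsetP=> u.
  rewrite in_setD1 inE => /andP[uy zu]; rewrite inE (e_solo _ _ _ zy zu) 1?eq_sym //.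
  by case/and4P: zu => _ _ ->.
have N_gt0 z y : solo T z y -> 0 < N z.
  by move=> zy; apply/card_gt0P; exists y; rewrite inE.
pose w y := (\sum_(z | solo T z y) (N z)%:R^-1 : rat)%R.
have w_le : (\sum_(y in B) w y <= (s * #|T|)%:R)%R.
  rewrite /w (exchange_big_dep [pred z | (z \in S) && (f z \in T)]) /=; last first.
    by move=> y z _ /and4P[-> ->].
  have -> : s * #|T| = \sum_(z | (z \in S) && (f z \in T)) 1.
    rewrite (partition_big f (mem T)) /= => [|z /andP[]//].
    rewrite mulnC -sum_nat_const; apply: eq_bigr => c cT.
    rewrite -(card_cls_T cT) -sum1_card; apply: eq_bigl => z; rewrite inE.
    by case: eqP => [->|]; rewrite ?andbF // cT !andbT.
  rewrite natr_sum; apply: ler_sum => z _.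
  rewrite sumr_const.
  case: (posnP (N z)) => [->|Nz]; first by rewrite invr0 mul0rn ler01.
  rewrite -[X in (X <= _)%R]mulr_natl ler_pdivrMr ?ltr0n // mul1r ler_nat.
  apply/subset_leq_card/subsetP=> y; rewrite !inE unfold_in /=.
  by case/andP.
have w_ge y : y \in B -> (#|T|%:R / (#|K| - #|A|)%:R <= w y)%R.
  move=> yB; have d1 := card_solo yB; have d2 := degB yB; have d3 := card_terminal_gt T0.
  (* With t = #|T|, k = #|K| - #|A| and d = #|nbr B y|, the middle term is at least 1 + (t - k) / (d
     + 1), hence at least t / k, because t > k and d + 1 <= k. *)
  apply: le_trans (_ : (#|[set z | solo T z y]|%:R / #|nbr B y|.+1%:R <= _)%R).
    rewrite ler_pdivrMr ?ltr0n; last by move: d2; clear; lia.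
    rewrite mulrAC ler_pdivlMr ?ltr0n // -!natrM ler_nat.
    move: d1 d2 d3; clear; set x := #|[set _ | _]|; set k := #|K|; nia.
  rewrite /w [X in (_ / _ <= X)%R](eq_bigl [in [set z | solo T z y]]); last first.
    by move=> z; rewrite inE.
  rewrite mulr_natl -sumr_const; apply: ler_sum => z; rewrite inE => zy.
  by rewrite lef_pV2 ?posrE ?ltr0n ?(N_gt0 _ _ zy) // ler_nat N_le.
have : (#|B|%:R * (#|T|%:R / (#|K| - #|A|)%:R) <= (s * #|T|)%:R :> rat)%R.
  by rewrite mulr_natl -sumr_const; apply: le_trans w_le; apply: ler_sum.
have k0 : 0 < #|K| - #|A| by rewrite subn_gt0 card_acc_lt.
rewrite mulrA ler_pdivrMr ?ltr0n // -!natrM ler_nat cardB.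
have := card_terminal_gt T0; clear; nia.
Qed.

End Terminal.

End NearlyEquitable.

End Coloring.

(** Induction on the number of inaccessible classes: if b is accessible its surplus is shifted to a;
    otherwise a solo vertex either finishes the coloring or yields a swap with more accessible
    classes. *)
Lemma near_equitable (V C : finType) (e : rel V) (s : nat) (S : {set V})
    (K : {set C}) (a b : C) (f : V -> C) : symmetric e -> irreflexive e ->
    0 < s -> a \in K -> b \in K -> near e s f S K a b ->
    {in S, forall x, #|nbr e S x| < #|K|} ->
    (forall (S' : {set V}) (K' : {set C}), #|K'| < #|K| -> K' != set0 -> #|S'| = s * #|K'| ->
       {in S', forall x, #|nbr e S' x| < #|K'|} ->
     exists g : V -> C, coloring e g S' K' (fun=> s)) ->
  exists g : V -> C, coloring e g S K (fun=> s).
Proof.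
move=> e_sym e_irr s0 aK bK near_f degS IH.
have [m] := ubnP (#|K| - #|acc e f S K a|).
elim: m f b bK near_f => // m IHm f b bK near_f; rewrite ltnS => le_m.
have [bA|bA] := boolP (b \in acc e f S K a).
  move: bA; rewrite inE bK => /connectP[p0 pth0]; case/shortenP: pth0 => p pth up _ la.
  have [g [colg _ _ _]] := shift_path e_sym e_irr near_f pth up.
  exists g; apply: coloring_ext colg => d dK; rewrite -la.
  by case: (d == a); case: (d == b); clear -s0; lia.
have A1 := acc_gt1 e_sym s0 aK bK near_f degS bA.
have [U [T [[TA T0 aT UA UT] [T_term T_out]]]] := terminal_classes aK A1.
have [|noM] := boolP [exists p : V * (V * C), [&& solo e S K a f T p.1 p.2.1,
    p.2.2 \in acc e f S K a, p.2.2 != f p.1 & nbr e (cls f S p.2.2) p.1 == set0]].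
  case/existsP=> -[z [y c]] /= /and4P[zy cA cz /eqP zc].
  exact: (solo_movable e_sym e_irr s0 aK bK near_f degS bA IH TA aT T_term zy cA cz zc).
have blocked z y : solo e S K a f T z y ->
    {in acc e f S K a, forall c, c != f z -> nbr e (cls f S c) z != set0}.
  move=> zy c cA cz; apply: contraNN noM => zc.
  by apply/existsP; exists (z, (y, c)); rewrite /= zy cA cz zc.
have [z [y1 [y2 [zy1 zy2 y12 ney]]]] :=
  solo_pair e_sym aK bK near_f degS bA TA aT UA UT T_out blocked T0.
have [g [b' [b'K near_g ltA]]] := solo_swap e_sym e_irr s0 aK bK near_f degS bA IH
  TA aT T_term zy1 zy2 y12 ney (blocked z y1 zy1).
apply: IHm near_g _ => //.
have := card_acc_lt bK bA; move: le_m ltA; clear; lia.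
Qed.

Lemma equitable_edgeless (V C : finType) (e : rel V) s (S : {set V}) (K : {set C}) :
    {in S &, forall x y, ~~ e x y} -> K != set0 -> #|S| = s * #|K| ->
  exists f : V -> C, coloring e f S K (fun=> s).
Proof.
have [m] := ubnP #|K|; elim: m S K => // m IH S K; rewrite ltnS => Km eS.
case/set0Pn=> c cK SK.
have colc (B : {set V}) : B \subset S -> #|B| = s -> coloring e (fun=> c) B [set c] (fun=> s).
  move=> BS Bs; split=> [x y xB yB|x _|d].
  - by rewrite (negbTE (eS _ _ _ _)) // (subsetP BS).
  - by rewrite inE.
  - rewrite inE => /eqP ->; rewrite -Bs; apply: eq_card => x.
    by rewrite inE eqxx andbT.
have [K0|K0] := eqVneq (K :\ c) set0.
  exists (fun=> c); rewrite -(setD1K cK) K0 setU0; apply: colc => //.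
  by rewrite SK (cardsD1 c) cK K0 cards0 muln1.
have : s <= #|S| by rewrite SK leq_pmulr // (cardD1 c) cK.
case/card_geqP => l [ul sl lS]; pose B := [set x in l].
have BS : B \subset S by apply/subsetP=> x; rewrite inE; apply: lS.
have Bs : #|B| = s by rewrite cardsE (card_uniqP ul).
have [|x y|//||g colg] := IH (S :\: B) (K :\ c).
- by move: Km; rewrite (cardsD1 c) cK.
- by rewrite !in_setD => /andP[_ xS] /andP[_ yS]; apply: eS.
- by rewrite cardsDS // SK Bs (cardsD1 c K) cK mulnDr muln1 addKn.
have dSB : [disjoint B & S :\: B].
  by rewrite disjoint_sym disjoints_subset; apply/subsetP=> x; rewrite in_setD in_setC => /andP[].
have dcK : [disjoint [set c] & K :\ c] by rewrite disjoints1 in_setD1 eqxx.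
have := coloring_merge dSB dcK (colc B BS Bs) colg.
rewrite setD1K // (_ : B :|: (S :\: B) = S); last first.
  by rewrite -{1}(setIidPr BS) setID.
move=> colS; eexists; exact: colS.
Qed.

(* Following Kierstead and Kostochka: the vertices of U carry edges, and adding
   a vertex to U turns an equitable coloring into a nearly equitable one. *)
Theorem Hajnal_Szemeredi (V C : finType) (e : rel V) s (S : {set V}) (K : {set C}) :
    symmetric e -> irreflexive e -> K != set0 -> #|S| = s * #|K| ->
    {in S, forall x, #|nbr e S x| < #|K|} ->
  exists f : V -> C, coloring e f S K (fun=> s).
Proof.
case: (posnP s) => [->|s0].
  move=> _ _ K0 /eqP; rewrite mul0n cards_eq0 => /eqP -> _.
  by apply: equitable_edgeless; rewrite // ?cards0 // => x y; rewrite inE.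
have [m] := ubnP #|K|; elim: m e S K => // m IH e S K; rewrite ltnS => Km.
move=> e_sym e_irr K0 SK degS.
pose eU (U : {set V}) : rel V := fun x y => [&& e x y, x \in U & y \in U].
have eU_sym U : symmetric (eU U) by move=> x y; rewrite /eU e_sym; congr (_ && _); rewrite andbC.
have eU_irr U : irreflexive (eU U) by move=> x; rewrite /eU e_irr.
have deg_eU U : {in S, forall x, #|nbr (eU U) S x| < #|K|}.
  move=> x xS; apply: leq_ltn_trans (degS x xS); apply/subset_leq_card/subsetP=> y.
  by rewrite !inE => /and4P[-> ->].
suff H n (U : {set V}) : U \subset S -> #|U| = n ->
    exists f : V -> C, coloring (eU U) f S K (fun=> s).
  have [f [fP fK fn]] := H _ S (subxx _) erefl.
  by exists f; split=> // x y xS yS xy; apply: fP; rewrite // /eU xy xS.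
elim: n U => [|n IHn] U US.
  move/eqP; rewrite cards_eq0 => /eqP ->; apply: equitable_edgeless => // x y _ _.
  by rewrite /eU !in_set0 !andbF.
move=> Un; have /card_gt0P[x xU] : 0 < #|U| by rewrite Un.
have xS := subsetP US x xU.
have [|f colf] := IHn (U :\ x) (subset_trans (subsetDl _ _) US).
  by move: Un; rewrite (cardsD1 x) xU => -[].
have [fP fK fn] := colf.
have colf1 : coloring (eU U) f (S :\ x) K (fun c => s - (c == f x)).
  have [_ fK1 fn1] := coloring_del xS colf; split=> // y z.
  rewrite !in_setD1 => /andP[yx yS] /andP[zx zS] /and3P[yz yU zU].
  by apply: fP => //; rewrite /eU yz !in_setD1 yx yU zx zU.
(* The fewer than #|K| neighbors of x cannot meet every class. Moving x to c leaves its old class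
   one short and c one over. *)
have [c cK xc] : exists2 c, c \in K & nbr (eU U) (cls f (S :\ x) c) x = set0.
  case: (pickP [pred c in K | nbr (eU U) (cls f (S :\ x) c) x == set0]).
    by move=> c /andP[cK /eqP c0]; exists c.
  move=> noc.
  have := deg_eU U x xS; rewrite ltnNge => /negP[].
  apply: leq_trans (_ : #|nbr (eU U) (S :\ x) x| <= _).
    rewrite (nbr_split (eU U) f (S :\ x) K) -sum1_card; apply: leq_trans (leq_addl _ _).
    by apply: leq_sum => c cK; rewrite card_gt0; have := noc c; rewrite inE /= cK /= => ->.
  by apply/subset_leq_card/subsetP=> y; rewrite !in_set => /andP[/andP[_ ->]].
have xSx : x \notin S :\ x by rewrite in_setD1 eqxx.
have := coloring_add (eU_sym U) (eU_irr U) xSx cK xc colf1.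
rewrite setD1K // => colg.
apply: (@near_equitable _ _ _ _ _ _ (f x) c) => //; first exact: fK.
  by apply: coloring_ext colg => d dK; case: (d == c); case: (d == f x); clear -s0; lia.
move=> S' K' ltK K'0 SK' deg'; apply: IH => //.
exact: leq_trans ltK Km.
Qed.

(** * Cliques, tilings and color counts *)

Section Tilings.
Variables (V : finType) (G : sgraph V) (r : nat).
Implicit Types (P : {set {set V}}) (S A B X : {set V}).

(** Contains v itself, which supplies the strict degree bound in [exists_Kr_partition]. *)
Definition nonnbr v := [set u | ~~ adj G v u].

Lemma card_nonnbr v : #|nonnbr v| = #|V| - degree G v.
Proof.
rewrite /degree -(cardsC [set u | adj G v u]) addKn.
by apply: eq_card => u; rewrite !inE.
Qed.

Lemma cliqueP B : reflect {in B &, forall x y, x != y -> adj G x y} (clique G B).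
Proof.
apply: (iffP forall_inP) => [BP x y xB yB xy|BP x xB].
  by have /forall_inP /(_ y yB) := BP x xB; rewrite xy.
by apply/forall_inP=> y yB; apply/implyP; apply: BP.
Qed.

Lemma clique_add v A : clique G A -> {in A, forall a, adj G v a} -> clique G (v |: A).
Proof.
move=> /cliqueP AP vA; apply/cliqueP=> x y /setU1P[->|xA] /setU1P[->|yA].
- by rewrite eqxx.
- by move=> _; apply: vA.
- by move=> _; rewrite adj_sym; apply: vA.
- exact: AP.
Qed.

(** [Kr_tiling] relative to a vertex set, since switchers and the remaining vertices are tiled
    separately. *)
Definition Kr_partition P S :=
  partition P S && [forall B in P, (#|B| == r) && clique G B].

Lemma Kr_partition_block P S B : Kr_partition P S -> B \in P ->
  [/\ #|B| = r, clique G B & B \subset S].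
Proof.
case/andP=> pP /forall_inP allP BP; have /andP[/eqP cB clB] := allP B BP.
split=> //; case/and3P: pP => /eqP <- _ _.
exact: bigcup_sup.
Qed.

Hypothesis r_gt0 : 0 < r.

Lemma Kr_partition_add P S B : Kr_partition P S -> #|B| = r -> clique G B ->
  [disjoint B & S] -> Kr_partition (B |: P) (B :|: S) /\ B \notin P.
Proof.
move=> PS cB clB BS; have B0 : B != set0 by rewrite -card_gt0 cB.
have BP : B \notin P.
  apply: contraL BS => BP; have [_ _ sB] := Kr_partition_block PS BP.
  by rewrite disjoints_subset; apply: contra B0 => sBC;
    rewrite -subset0 -(setICr S) subsetI sB.
case/andP: PS => pP /forall_inP allP; split=> //; apply/andP; split.
  exact: partitionU1.
by apply/forall_inP=> D /setU1P[->|/allP //]; rewrite cB eqxx.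
Qed.

(** An equitable coloring of the complement graph with #|S| / r colors has classes of size r that
    are cliques of G. *)
Lemma exists_Kr_partition S : r %| #|S| ->
  {in S, forall v, #|S :&: nonnbr v| <= #|S| %/ r} -> exists P, Kr_partition P S.
Proof.
move=> rS nS; have [->|S0] := eqVneq S set0.
  by exists set0; rewrite /Kr_partition partition_set0 eqxx; apply/forall_inP=> B; rewrite inE.
pose k := #|S| %/ r; have k0 : 0 < k by rewrite divn_gt0 // dvdn_leq // card_gt0.
pose e : rel V := fun x y => (x != y) && ~~ adj G x y.
have [||||x xS|f [fP _ fn]] := @Hajnal_Szemeredi V 'I_k e r S [set: 'I_k].
- by move=> x y; rewrite /e eq_sym adj_sym.
- by move=> x; rewrite /e eqxx.
- by rewrite -card_gt0 cardsT card_ord.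
- by rewrite cardsT card_ord /k mulnC divnK.
- rewrite cardsT card_ord; apply: leq_trans (nS x xS).
  rewrite [X in _ < X](cardsD1 x) !inE xS adj_irr ltnS.
  apply/subset_leq_card/subsetP=> y; rewrite !inE /e eq_sym.
  by case/and3P=> -> -> ->.
exists (preim_partition f S); apply/andP; split; first exact: preim_partitionP.
apply/forall_inP=> B /imsetP[x xS ->]; apply/andP; split.
  rewrite -(fn (f x)) ?inE //; apply/eqP/eq_card => y.
  by rewrite !inE eq_sym.
apply/cliqueP=> y z; rewrite !inE => /andP[yS /eqP fy] /andP[zS /eqP fz] yz.
apply: contraT => nyz; have := fP y z yS zS.
by rewrite /e yz nyz -fy fz eqxx => /(_ isT).
Qed.

Section Colors.
Variables (q : nat) (f : {set V} -> 'I_q).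

Definition pairs c B := [set e : {set V} | [&& e \subset B, #|e| == 2 & f e == c]].
Definition cnt c P := \sum_(B in P) #|pairs c B|.

Lemma cnt_add c P B : B \notin P -> cnt c (B |: P) = #|pairs c B| + cnt c P.
Proof. by move=> BP; rewrite /cnt big_setU1. Qed.

Lemma sum_pairs B : \sum_c #|pairs c B| = 'C(#|B|, 2).
Proof.
rewrite -cards_draws -sum1_card (partition_big f predT) //=.
apply: eq_bigr => c _; rewrite -sum1_card; apply: eq_bigl => e.
by rewrite !inE andbA.
Qed.

Lemma sum_cnt P S : Kr_partition P S -> \sum_c cnt c P = (#|S| %/ r) * 'C(r, 2).
Proof.
move=> PS; rewrite /cnt exchange_big /=.
rewrite (eq_bigr (fun=> 'C(r, 2))) => [|B BP]; last first.
  by rewrite sum_pairs; have [->] := Kr_partition_block PS BP.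
rewrite sum_nat_const; congr (_ * _); case/andP: (PS) => pP _.
have cP : {in P, forall B : {set V}, #|B| = r}.
  by move=> B BP; have [] := Kr_partition_block PS BP.
by rewrite (card_uniform_partition cP pP) mulnK.
Qed.

Lemma edges_tiling P e : (e \in edges (tiling_graph P)) =
  (#|e| == 2) && [exists B in P, e \subset B].
Proof.
apply/imsetP/andP=> [[[x y] /=]|[/cards2P[x [y [xy ->]]] /exists_inP[B BP eB]]].
  rewrite inE => /andP[xy /exists_inP[B BP /andP[xB yB]]] ->.
  split; first by rewrite cards2 xy.
  by apply/exists_inP; exists B; rewrite // subUset !sub1set xB.
exists (x, y) => //; rewrite inE /= /tiling_adj xy /=.
by move: eB; rewrite subUset !sub1set => eB; apply/exists_inP; exists B.
Qed.

(** Blocks are disjoint, so a pair of vertices lies in at most one of them and no edge is counted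
    twice in [cnt]. *)
Lemma card_color_class P S c : Kr_partition P S ->
  #|color_class (tiling_graph P) f c| = cnt c P.
Proof.
case/andP=> /and3P[_ /trivIsetP tP _] _.
have -> : cnt c P = \sum_(B in P) \sum_(e in color_class (tiling_graph P) f c) (e \subset B).
  apply: eq_bigr => B BP; rewrite -big_mkcondr /= -sum1_card; apply: eq_bigl => e.
  rewrite [in RHS]inE edges_tiling !inE.
  case eB: (e \subset B); rewrite ?andbF //= andbT; case: (_ == 2) => //=.
  by rewrite (_ : [exists B in P, e \subset B] = true) //; apply/exists_inP; exists B.
rewrite exchange_big /= -sum1_card; apply: eq_bigr => e.
rewrite inE edges_tiling => /andP[/andP[/eqP e2 /exists_inP[B BP eB]] _].
rewrite (bigD1 B) //= eB big1 // => D /andP[DP DB].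
case eD: (e \subset D) => //.
have /disjoint_setI0 := tP D B DP BP DB.
have : e \subset D :&: B by rewrite subsetI eD.
by move=> + DB0; rewrite DB0 subset0 -cards_eq0 e2.
Qed.

Lemma card_edges_tiling P S : Kr_partition P S ->
  #|edges (tiling_graph P)| = (#|S| %/ r) * 'C(r, 2).
Proof.
move=> PS; rewrite -(sum_cnt PS) -sum1_card (partition_big f predT) //=.
apply: eq_bigr => c _; rewrite -(card_color_class c PS) -sum1_card.
by apply: eq_bigl => e; rewrite inE.
Qed.

(* If no color of P2 exceeds the average, then color c of P2 is not far below
   it, so that color c of P1 exceeds it. *)
Lemma unbalanced_of_gap P1 P2 S c m :
    Kr_partition P1 S -> Kr_partition P2 S -> cnt c P2 + m <= cnt c P1 ->
  exists P d, Kr_partition P S /\ (#|S| %/ r) * 'C(r, 2) + m <= q * cnt d P.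
Proof.
set E := _ * _ => PS1 PS2 gap.
case: (leqP (E + m) (q * cnt c P1)) => [|lt1]; first by exists P1, c.
have [/existsP[d dP]|] := boolP [exists d, E + m <= q * cnt d P2]; first by exists P2, d.
rewrite negb_exists => /forallP lt2; exfalso.
have lo : \sum_(d < q | d != c) q * cnt d P2 <= (q - 1) * (E + m).
  have -> : q - 1 = #|predC1 c| by rewrite cardC1 card_ord subn1.
  rewrite -sum_nat_const.
  by apply: leq_sum => d _; apply: ltnW; rewrite ltnNge.
have tot : q * cnt c P2 + \sum_(d < q | d != c) q * cnt d P2 = q * E.
  by rewrite -big_distrr -mulnDr /E -(sum_cnt PS2) [in RHS](bigD1 c).
have q0 : 0 < q by apply: leq_ltn_trans (ltn_ord c).
have := leq_mul (leqnn q) gap; rewrite mulnDr; move: lo tot lt1 q0.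
move: (\sum_(_ < q | _) _) (cnt c P1) (cnt c P2) (E) => t x y n; clear.
by case: q => // p; rewrite subn1 /= !mulSn !mulnDr; lia.
Qed.

Definition chi c x y : nat := f [set x; y] == c.

Lemma chi_sym c x y : chi c x y = chi c y x.
Proof. by rewrite /chi setUC. Qed.

Lemma card_pairs_add c u A : u \notin A ->
  #|pairs c (u |: A)| = #|pairs c A| + \sum_(a in A) chi c u a.
Proof.
move=> uA; rewrite -(cardsID [set e : {set V} | u \in e]) addnC; congr (_ + _).
  apply: eq_card => e; rewrite !inE; case ue: (u \in e) => /=.
    by rewrite [e \subset A](_ : _ = false) //; apply: contraNF uA => /subsetP; apply.
  congr (_ && _); apply/subsetP/subsetP=> eA x xe.
    by case/setU1P: (eA x xe) => // xu; rewrite -xu xe in ue.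
  by rewrite inE eA ?orbT.
rewrite -sum1_card (eq_bigl [in [set [set u; a] | a in [set a in A | f [set u; a] == c]]]).
  rewrite sum1_card card_in_imset => [|x y].
    rewrite -sum1_card [RHS](bigID [pred a | f [set u; a] == c]) /= [X in _ + X]big1.
      rewrite addn0 (eq_bigl [pred a | (a \in A) && (f [set u; a] == c)]); last first.
        by move=> a; rewrite inE.
      by apply: eq_bigr => a /andP[_ ac]; rewrite /chi ac.
    by move=> a /andP[_ /negbTE ac]; rewrite /chi ac.
  rewrite !inE => /andP[xA _] /andP[yA _] /setP/(_ x); rewrite !inE eqxx orbT.
  by case: eqP => [xu|_ /esym/eqP //]; rewrite -xu xA in uA.
move=> e; apply/idP/imsetP => [|[a]].
  rewrite !inE => /andP[/and3P[eA /cards2P[x [y [xy eE]]] ec]]; subst e.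
  rewrite !inE => uxy; move: eA; rewrite subUset !sub1set !inE.
  move: xy ec uxy; case: (eqVneq u x) => [<-|ux] uy ec.
    move=> _ /=; rewrite [y == u]eq_sym (negbTE uy) /= => yA.
    by exists y; rewrite // inE yA.
  rewrite /= => /eqP uyE; subst y; rewrite /= => /andP[xA _].
  by exists x; rewrite ?inE ?xA setUC.
rewrite inE => /andP[aA ac] ->; rewrite !inE ac eqxx !andbT.
rewrite cards2 (_ : u != a); last by apply: contraNneq uA => ->.
by rewrite subUset !sub1set !inE eqxx aA orbT.
Qed.

End Colors.

End Tilings.

(** * Switchers in dense graphs *)

Section Dense.
Variables (V : finType) (G : sgraph V) (r q h : nat) (f : {set V} -> 'I_q).
Implicit Types (X Y A B T : {set V}) (c : 'I_q).
Hypotheses (r_ge3 : 3 <= r) (h_gt0 : 0 < h) (V_gt0 : 0 < #|V|).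
Hypothesis nonnbr_le : forall v, r.+1 * (#|nonnbr G v| + h) <= #|V|.

Local Notation chi := (chi f).

Let r_gt0 : 0 < r. Proof. exact: leq_trans r_ge3. Qed.

Lemma rh_le : r.+1 * h <= #|V|.
Proof.
have /card_gt0P[v _] := V_gt0; apply: leq_trans (nonnbr_le v).
by rewrite leq_mul2l leq_addl orbT.
Qed.

(** Each vertex has at most #|V| / (r + 1) - h nonneighbors, so r + 1 vertices together exclude at
    most #|V| - (r + 1) h. *)
Lemma common_nbr (l : seq V) Y : size l <= r.+1 -> #|Y| < r.+1 * h ->
  exists2 w, w \notin Y & {in l, forall x, adj G x w}.
Proof.
move=> sl ltY; pose N := \bigcup_(x <- l) nonnbr G x.
have leN : r.+1 * #|N| + r.+1 * r.+1 * h <= r.+1 * #|V|.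
  have : r.+1 * #|N| <= size l * (#|V| - r.+1 * h).
    rewrite /N; elim: l {sl N} => [|x l IH]; first by rewrite big_nil cards0 muln0.
    rewrite big_cons /= mulSn; apply: leq_trans (leq_mul (leqnn r.+1) (leq_card_setU _ _)) _.
    rewrite mulnDr; apply: leq_add => //.
    by have := nonnbr_le x; rewrite mulnDr; move: (r.+1 * h) (r.+1 * _) #|V| => a b c; clear; lia.
  have := leq_mul sl (leqnn (#|V| - r.+1 * h)); have := rh_le.
  move: (r.+1) (size l) #|N| #|V| => a b n v; clear; rewrite mulnBr.
  by move=> *; have : a * (a * h) <= a * v; [rewrite leq_mul2l; lia|lia].
have ltNY : #|N :|: Y| < #|V|.
  apply: leq_ltn_trans (leq_card_setU _ _) _; rewrite -(ltn_pmul2l (ltn0Sn r)).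
  move: leN ltY; clear; move: (r.+1) (ltn0Sn r) => a a0; nia.
have /card_gt0P[w] : 0 < #|~: (N :|: Y)| by rewrite cardsCs setCK subn_gt0.
rewrite !inE negb_or => /andP[wN wY]; exists w => // x xl.
apply: contraNT wN => xw; rewrite /N; elim: l xl {sl N leN ltNY} => //= y l IH.
by rewrite inE big_cons in_setU => /predU1P[<-|/IH ->]; rewrite ?orbT // inE xw.
Qed.

(** Greedy; the last vertex of T must be adjacent to only [size l + j - 1] others, whence r + 2. *)
Lemma exists_clique (l : seq V) Y j : size l + j <= r.+2 -> #|Y| < r.+1 * h ->
  exists T, [/\ #|T| = j, clique G T, [disjoint T & Y]
    & {in l & T, forall x t, adj G x t}].
Proof.
move=> + ltY; elim: j => [_|j IH ltj].
  exists set0; split=> [|||x t _]; rewrite ?cards0 ?inE //.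
    by apply/cliqueP=> x y; rewrite inE.
  by rewrite -setI_eq0 set0I.
have [|T [cT clT dT lT]] := IH; first by move: ltj; clear; lia.
have [|w wY lw] := @common_nbr (l ++ enum T) Y _ ltY.
  by rewrite size_cat -cardE cT; move: ltj; clear; lia.
have wT : w \notin T.
  by apply/negP=> wT; have := lw w; rewrite mem_cat mem_enum wT orbT adj_irr => /(_ isT).
exists (w |: T); split.
- by rewrite cardsU1 wT cT.
- apply: clique_add => // t tT; rewrite adj_sym; apply: lw.
  by rewrite mem_cat mem_enum tT orbT.
- rewrite disjoints_subset subUset sub1set inE wY -disjoints_subset; exact: dT.
- move=> x t xl /setU1P[->|tT]; last exact: lT.
  by apply: lw; rewrite mem_cat xl.
Qed.

(* Replacing the cliques v |: A and u |: B by u |: A and v |: B gains edges of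
   color c. *)
Definition switch c u v A B :=
  [&& u != v, #|A| == r.-1, #|B| == r.-1, clique G A & clique G B] &&
  [&& [disjoint A & B], [forall a in A, adj G u a && adj G v a],
      [forall b in B, adj G u b && adj G v b]
    & #|pairs f c (v |: A)| + #|pairs f c (u |: B)| <
      #|pairs f c (u |: A)| + #|pairs f c (v |: B)|].

(** Greedy: collect disjoint switchers of 2 r vertices each until there are m of them or the
    collected set meets every switcher. The tiling of the rest is quantified over because it is
    chosen only once X is known. *)
Lemma many_switches c m :
  (exists2 X : {set V}, #|X| = 2 * r * m &
     forall (P0 : {set {set V}}) (S0 : {set V}), Kr_partition G r P0 S0 ->
     [disjoint X & S0] -> exists P1 P2 : {set {set V}},
     [/\ Kr_partition G r P1 (X :|: S0), Kr_partition G r P2 (X :|: S0)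
       & cnt f c P2 + m <= cnt f c P1]) \/
  (exists2 X : {set V}, #|X| <= 2 * r * m &
     forall u v A B, switch c u v A B -> ~~ [disjoint u |: A :|: (v |: B) & X]).
Proof.
elim: m => [|m [[X cX XP]|[X cX XP]]]; last first.
- by right; exists X => //; apply: leq_trans cX _; rewrite leq_mul2l leqnSn orbT.
- have [/existsP[[[u v] [A B]] /= /andP[sw dX]]|] :=
    boolP [exists p : (V * V) * ({set V} * {set V}),
    switch c p.1.1 p.1.2 p.2.1 p.2.2 &&
    [disjoint p.1.1 |: p.2.1 :|: (p.1.2 |: p.2.2) & X]]; last first.
    rewrite negb_exists => /forallP noS; right; exists X.
      by apply: leq_trans (eq_leq cX) _; rewrite leq_mul2l leqnSn orbT.
    move=> u v A B sw; have := noS ((u, v), (A, B)).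
    by rewrite /= sw.
  left; case/andP: sw => /and5P[uv /eqP cA /eqP cB clA clB].
  case/and4P=> dAB /forall_inP uvA /forall_inP uvB gain.
  have uA a : a \in A -> adj G u a by move/uvA/andP=> [].
  have vA a : a \in A -> adj G v a by move/uvA/andP=> [].
  have uB a : a \in B -> adj G u a by move/uvB/andP=> [].
  have vB a : a \in B -> adj G v a by move/uvB/andP=> [].
  have uA' : u \notin A by apply/negP=> /uA; rewrite adj_irr.
  have vA' : v \notin A by apply/negP=> /vA; rewrite adj_irr.
  have uB' : u \notin B by apply/negP=> /uB; rewrite adj_irr.
  have vB' : v \notin B by apply/negP=> /vB; rewrite adj_irr.
  have card1 x (D : {set V}) : x \notin D -> #|D| = r.-1 -> #|x |: D| = r.
    by move=> xD cD; rewrite cardsU1 xD cD add1n prednK.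
  have disj x y (D E : {set V}) : x != y -> x \notin E -> y \notin D -> [disjoint D & E] ->
      [disjoint x |: D & y |: E].
    move=> xy xE yD dDE; rewrite disjoints_subset; apply/subsetP=> z.
    rewrite in_setC !in_setU1 negb_or => /predU1P[->|zD]; first by rewrite xy.
    by rewrite (disjointFr dDE) // andbT; apply: contraNneq yD => <-.
  have vu : v != u by rewrite eq_sym.
  have swE : v |: A :|: (u |: B) = u |: A :|: (v |: B).
    by apply/setP=> z; rewrite !inE; do !case: (_ == _); do !case: (_ \in _).
  exists (u |: A :|: (v |: B) :|: X).
    rewrite cardsU (disjoint_setI0 dX) cards0 subn0 cX cardsU.
    rewrite (disjoint_setI0 (disj _ _ _ _ uv uB' vA' dAB)) cards0 !card1 //.
    by clear; rewrite mulnS; lia.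
  move=> P0 S0 PS0 dS0.
  have dXS : [disjoint X & S0].
    by apply: disjointWl dS0; apply: subsetUr.
  have dsw : [disjoint u |: A :|: (v |: B) & X :|: S0].
    rewrite disjoint_sym disjoints_subset subUset -!disjoints_subset.
    rewrite disjoint_sym dX disjoint_sym; apply: disjointWl dS0; exact: subsetUl.
  have two x y (D E : {set V}) P (S : {set V}) : [disjoint x |: D & y |: E] -> #|x |: D| = r ->
      #|y |: E| = r -> clique G (x |: D) -> clique G (y |: E) ->
      [disjoint x |: D :|: (y |: E) & S] -> Kr_partition G r P S ->
      exists2 Q, Kr_partition G r Q (x |: D :|: (y |: E) :|: S) &
        cnt f c Q = #|pairs f c (x |: D)| + #|pairs f c (y |: E)| + cnt f c P.
    move=> dxy c1 c2 cl1 cl2 dS PS.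
    have dyS : [disjoint y |: E & S] by apply: disjointWl dS; apply: subsetUr.
    have [PS1 nP1] := Kr_partition_add r_gt0 PS c2 cl2 dyS.
    have dxS : [disjoint x |: D & y |: E :|: S].
      rewrite disjoint_sym disjoints_subset subUset -!disjoints_subset.
      by rewrite disjoint_sym dxy disjoint_sym; apply: disjointWl dS; apply: subsetUl.
    have [PS2 nP2] := Kr_partition_add r_gt0 PS1 c1 cl1 dxS.
    exists (x |: D |: ((y |: E) |: P)); first by rewrite -setUA.
    by rewrite !cnt_add // addnA.
  have [P1 [P2 [PS1 PS2 gap]]] := XP P0 S0 PS0 dXS.
  have [Q1 QS1 cQ1] := two u v A B P1 _ (disj _ _ _ _ uv uB' vA' dAB)
    (card1 _ _ uA' cA) (card1 _ _ vB' cB) (clique_add clA uA) (clique_add clB vB) dsw PS1.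
  rewrite -swE in dsw.
  have [Q2 QS2 cQ2] := two v u A B P2 _ (disj _ _ _ _ vu vB' uA' dAB)
    (card1 _ _ vA' cA) (card1 _ _ uB' cB) (clique_add clA vA) (clique_add clB uB) dsw PS2.
  rewrite swE setUA in QS2; rewrite setUA in QS1.
  exists Q1, Q2; split=> //.
  by rewrite cQ1 cQ2; move: gap gain; clear; lia.
- left; exists set0; rewrite ?cards0 ?muln0 // => P0 S0 PS0 _.
  by exists P0, P0; rewrite set0U addn0.
Qed.

(** * Rigidity of colorings without switchers *)

Section NoSwitch.
Variable X : {set V}.
Hypothesis X_small : #|X| + r < r.+1 * h.
Hypothesis noswitch : forall c u v A B, switch c u v A B ->
  ~~ [disjoint u |: A :|: (v |: B) & X].

Let ltX : #|X| < r.+1 * h.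
Proof. exact: leq_ltn_trans (leq_addr _ _) X_small. Qed.

(** Neither (u, v) nor (v, u) is a switch, so both exchanges gain nothing, and the pairs inside A
    and inside B cancel. *)
Lemma exchange_balanced c u v A B : u != v -> u \notin X -> v \notin X ->
    #|A| = r.-1 -> #|B| = r.-1 -> clique G A -> clique G B -> [disjoint A & B] ->
    [disjoint A & X] -> [disjoint B & X] ->
    {in A, forall a, adj G u a && adj G v a} ->
    {in B, forall b, adj G u b && adj G v b} ->
  \sum_(a in A) chi c u a + \sum_(b in B) chi c v b =
  \sum_(a in A) chi c v a + \sum_(b in B) chi c u b.
Proof.
move=> uv uX vX cA cB clA clB dAB dAX dBX uvA uvB.
have notin x (D : {set V}) : {in D, forall a, adj G x a} -> x \notin D.
  by move=> xD; apply/negP=> /xD; rewrite adj_irr.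
have uA : u \notin A by apply: notin => a /uvA/andP[].
have vA : v \notin A by apply: notin => a /uvA/andP[].
have uB : u \notin B by apply: notin => a /uvB/andP[].
have vB : v \notin B by apply: notin => a /uvB/andP[].
have le x y : x != y -> x \notin X -> y \notin X ->
    {in A, forall a, adj G x a && adj G y a} ->
    {in B, forall a, adj G x a && adj G y a} ->
    #|pairs f c (x |: A)| + #|pairs f c (y |: B)| <=
    #|pairs f c (y |: A)| + #|pairs f c (x |: B)|.
  move=> xy xX yX xyA xyB; rewrite leqNgt; apply/negP=> gain.
  have : switch c x y A B.
    apply/andP; split; first by rewrite xy cA cB eqxx clA clB.
    rewrite dAB gain andbT /=; apply/andP.
    by split; apply/forall_inP => a aD; [apply: xyA|apply: xyB].
  move/noswitch/negP; apply.
  rewrite disjoints_subset !subUset !sub1set !in_setC xX yX -!disjoints_subset.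
  by rewrite dAX dBX.
have := le u v uv uX vX uvA uvB.
have := le v u; rewrite eq_sym => /(_ uv vX uX) le'.
have {le'} : #|pairs f c (v |: A)| + #|pairs f c (u |: B)| <=
    #|pairs f c (u |: A)| + #|pairs f c (v |: B)|.
  by apply: le' => a aD; rewrite andbC; [apply: uvA|apply: uvB].
rewrite !card_pairs_add //; clear.
move: #|_| #|_| (\sum_(_ in _) _) (\sum_(_ in _) _) => a b x y.
move: (\sum_(_ in _) _) (\sum_(_ in _) _) => z t; lia.
Qed.

(** Balance x |: T and y |: T against the same B and subtract: only the edges at x and y remain. The
    vertices w and w' are compared through a common neighbor z. *)
Lemma four_cycle c u v w w' : u \notin X -> v \notin X -> w \notin X -> w' \notin X ->
    adj G u w -> adj G v w -> adj G u w' -> adj G v w' ->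
  chi c u w + chi c v w' = chi c v w + chi c u w'.
Proof.
move=> uX vX wX w'X uw vw uw' vw'; have [->//|uv] := eqVneq u v.
have adj_case x y : x \notin X -> y \notin X -> adj G x y -> adj G u x -> adj G v x ->
    adj G u y -> adj G v y -> chi c u x + chi c v y = chi c v x + chi c u y.
  move=> xX yX xy ux vx uy vy.
  have [||T [cT clT dT lT]] := @exists_clique [:: u; v; x; y] X (r - 2).
  - by rewrite /=; move: r_ge3; clear; lia.
  - exact: ltX.
  have adjT z t : z \in [:: u; v; x; y] -> t \in T -> adj G z t by apply: lT.
  (* x, y and the r - 2 vertices of T are the r extra vertices allowed for in [X_small]. *)
  have lltY : #|X :|: (x |: (y |: T))| < r.+1 * h.
    apply: leq_ltn_trans X_small; apply: leq_trans (leq_card_setU _ _) _.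
    rewrite leq_add2l !cardsU1 cT; move: r_ge3; clear.
    by case: (_ \notin _); case: (_ \notin _) => /=; lia.
  have [||B [cB clB dB lB]] := @exists_clique [:: u; v] (X :|: (x |: (y |: T))) r.-1.
  - by rewrite /=; move: r_ge3; clear; lia.
  - exact: lltY.
  have dBX : [disjoint B & X] by apply: disjointWr dB; apply: subsetUl.
  have dBT (D : {set V}) : D \subset x |: (y |: T) -> [disjoint D & B].
    move=> sD; rewrite disjoint_sym; apply: disjointWr dB.
    by apply: subset_trans sD _; apply: subsetUr.
  have uvB : {in B, forall b, adj G u b && adj G v b}.
    by move=> b bB; rewrite !lB // !inE eqxx ?orbT.
  have eqz z : z \in [:: x; y] -> z \notin X -> adj G u z -> adj G v z ->
      chi c u z + \sum_(t in T) chi c u t + \sum_(b in B) chi c v b =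
      chi c v z + \sum_(t in T) chi c v t + \sum_(b in B) chi c u b.
    move=> zxy zX uz vz.
    have zT : {in T, forall t, adj G z t}.
      by move=> t tT; apply: adjT; rewrite // !inE in zxy *; rewrite zxy !orbT.
    have nzT : z \notin T by apply/negP=> /zT; rewrite adj_irr.
    have := @exchange_balanced c u v (z |: T) B uv uX vX.
    rewrite !big_setU1 //; apply=> //.
    - by rewrite cardsU1 nzT cT; move: r_ge3; clear; lia.
    - exact: clique_add.
    - apply: dBT; rewrite subUset sub1set; move: zxy; rewrite !inE => /orP[]->;
        by rewrite ?orbT /= setUA subsetUr.
    - by rewrite disjoints_subset subUset sub1set inE zX -disjoints_subset.
    - move=> a /setU1P[->|aT]; first by rewrite uz.
      by rewrite !adjT // !inE eqxx ?orbT.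
  have := eqz x; rewrite !inE eqxx => /(_ isT xX ux vx).
  have := eqz y; rewrite !inE eqxx orbT => /(_ isT yX uy vy).
  move: (chi c u x) (chi c u y) (chi c v x) (chi c v y); clear.
  move: (\sum_(_ in _) _) (\sum_(_ in _) _) => p1 p2.
  move: (\sum_(_ in _) _) (\sum_(_ in _) _) => p3 p4; lia.
have [|//|z zX lz] := @common_nbr [:: u; v; w; w'] X.
  by rewrite /=; move: r_ge3; clear; lia.
have zadj y : y \in [:: u; v; w; w'] -> adj G y z by apply: lz.
have := adj_case w z wX zX; rewrite !zadj ?inE ?eqxx ?orbT // => /(_ isT uw vw isT isT).
have := adj_case w' z w'X zX; rewrite !zadj ?inE ?eqxx ?orbT // => /(_ isT uw' vw' isT isT).
move: (chi c u w) (chi c v w) (chi c u w') (chi c v w') (chi c u z) (chi c v z).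
by clear; lia.
Qed.

Definition triangle u x y := [&& u \notin X, x \notin X & y \notin X] &&
  [&& adj G u x, adj G u y & adj G x y].

Definition apex_weight c u x y : int := ((chi c u x + chi c u y)%:Z - (chi c x y)%:Z)%R.

(** Replacing t by t' is the identity of the 4-cycle u t z t'. With z a common neighbor of u, x and
    x', three such replacements lead through xz and zx' to x'y'. *)
Lemma apex_weight_indep c u x y x' y' : triangle u x y -> triangle u x' y' ->
  apex_weight c u x y = apex_weight c u x' y'.
Proof.
have step z t t' : triangle u z t -> triangle u z t' ->
    apex_weight c u z t = apex_weight c u z t'.
  case/andP=> /and3P[uX zX tX] /and3P[uz ut zt] /andP[/and3P[_ _ t'X] /and3P[_ ut' zt']].
  have := four_cycle c uX zX tX t'X ut zt ut' zt'; rewrite /apex_weight; clear; lia.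
have sym z t : apex_weight c u z t = apex_weight c u t z.
  by rewrite /apex_weight addnC [chi c z t]chi_sym.
move=> t1 t2; case/andP: (t1) => /and3P[uX xX yX] /and3P[ux uy xy].
case/andP: (t2) => /and3P[_ x'X y'X] /and3P[ux' uy' xy'].
have [|//|z zX lz] := @common_nbr [:: u; x; x'] X; first by rewrite /=; move: r_ge3; clear; lia.
have [uz xz xz'] : [/\ adj G u z, adj G x z & adj G x' z].
  by split; apply: lz; rewrite !inE eqxx ?orbT.
have txz : triangle u x z by rewrite /triangle uX xX zX ux uz xz.
have tzx : triangle u z x by rewrite /triangle uX xX zX ux uz [adj G z x]adj_sym xz.
have tzx' : triangle u z x' by rewrite /triangle uX x'X zX ux' uz [adj G z x']adj_sym xz'.
have tx'z : triangle u x' z by rewrite /triangle uX x'X zX ux' uz xz'.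
have e1 := step _ _ _ t1 txz; have e2 := step _ _ _ tzx tzx'.
have e3 := step _ _ _ tx'z t2.
exact: etrans e1 (etrans (sym x z) (etrans e2 (etrans (sym z x') e3))).
Qed.

(* The value 0 is never used: every vertex outside X lies in a triangle. *)
Definition weight c u : int :=
  if [pick p | triangle u p.1 p.2] is Some p then apex_weight c u p.1 p.2 else 0%R.

Lemma weightE c u x y : triangle u x y -> weight c u = apex_weight c u x y.
Proof.
move=> txy; rewrite /weight; case: pickP => [p tp|noT].
  exact: apex_weight_indep.
by have := noT (x, y); rewrite txy.
Qed.

Lemma triangle_ext u v : u \notin X -> v \notin X -> adj G u v ->
  exists x, triangle u v x.
Proof.
move=> uX vX uv.
have [|//|x xX lx] := @common_nbr [:: u; v] X; first by rewrite /=; move: r_ge3; clear; lia.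
by exists x; rewrite /triangle uX vX xX uv !lx // !inE eqxx ?orbT.
Qed.

Lemma weight_edge c u v : u \notin X -> v \notin X -> adj G u v ->
  (weight c u + weight c v = (chi c u v).*2%:Z)%R.
Proof.
move=> uX vX uv; have [x tx] := triangle_ext uX vX uv.
have ty : triangle v u x.
  by move: tx; rewrite /triangle uX vX [adj G v u]adj_sym uv /= [adj G v x && _]andbC.
rewrite (weightE c tx) (weightE c ty) /apex_weight [chi c v u]chi_sym.
by clear; lia.
Qed.

Lemma sum_weight u : u \notin X -> (\sum_c weight c u = 1)%R.
Proof.
move=> uX.
have [//|//|v vX lv] := @common_nbr [:: u] X.
have uv : adj G u v by apply: lv; rewrite inE.
have [x tx] := triangle_ext uX vX uv.
under eq_bigr do rewrite (weightE _ tx) /apex_weight.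
have sum_chi y z : \sum_c chi c y z = 1.
  rewrite (bigD1 (f [set y; z])) //= /chi eqxx big1 // => c.
  by rewrite eq_sym => /negbTE ->.
by rewrite sumrB -!(big_morph Posz PoszD (erefl _)) big_split /= !sum_chi.
Qed.

Definition exceptional := [set u | (u \notin X) && [exists c, (weight c u < 0)%R]].

(** If u has negative weight in c, its neighbors z and t have positive weight in c, so an edge zt
    has color c. A common edge zt thus gives u and v the same c, and the edge uv would have a
    negative sum of weights. *)
Lemma exceptional_indep u v : u \in exceptional -> v \in exceptional -> ~~ adj G u v.
Proof.
rewrite !inE => /andP[uX /existsP[c uc]] /andP[vX /existsP[d vd]]; apply/negP=> uv.
have [|//|z zX lz] := @common_nbr [:: u; v] X; first by rewrite /=; move: r_ge3; clear; lia.
have [|//|t tX lt] := @common_nbr [:: u; v; z] X; first by rewrite /=; move: r_ge3; clear; lia.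
have [uz vz] : adj G u z /\ adj G v z by split; apply: lz; rewrite !inE eqxx ?orbT.
have [ut vt zt] : [/\ adj G u t, adj G v t & adj G z t].
  by split; apply: lt; rewrite !inE eqxx ?orbT.
have zt_color b y : y \notin X -> adj G y z -> adj G y t -> (weight b y < 0)%R ->
    f [set z; t] = b.
  move=> yX yz yt yb; have := weight_edge b zX tX zt.
  have := weight_edge b yX zX yz; have := weight_edge b yX tX yt.
  rewrite /chi; case: (f [set z; t] =P b) => // _; move: yb; clear.
  by case: (_ == b); case: (_ == b) => /=; lia.
have cd : c = d by rewrite -(zt_color c u) // -(zt_color d v).
have := weight_edge c uX vX uv; move: uc vd; rewrite cd; clear; lia.
Qed.

(** The weights at u are nonnegative integers with sum 1. *)
Lemma ordinary_color u c d : u \notin X -> u \notin exceptional ->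
  (weight c u = 1)%R -> (weight d u = 1)%R -> c = d.
Proof.
move=> uX; rewrite inE uX negb_exists => /forallP u0 uc ud; apply/eqP/negPn/negP=> cd.
have := sum_weight uX; rewrite (bigD1 c) //= (bigD1 d) //=; last by rewrite eq_sym.
rewrite uc ud; have : (0 <= \sum_(i < q | (i != c) && (i != d)) weight i u)%R.
  by apply: sumr_ge0 => b _; rewrite leNgt u0.
by move: (\sum_(_ < q | _) _)%R => s; clear; lia.
Qed.

Lemma ordinary_edge u v : u \notin X -> v \notin X -> u \notin exceptional ->
  v \notin exceptional -> adj G u v -> (weight (f [set u; v]) u = 1)%R.
Proof.
move=> uX vX uI vI uv; have := weight_edge (f [set u; v]) uX vX uv.
have le1 x c : x \notin X -> x \notin exceptional -> (weight c x <= 1)%R.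
  move=> xX; rewrite inE xX negb_exists => /forallP x0.
  have := sum_weight xX; rewrite (bigD1 c) //=.
  have : (0 <= \sum_(i < q | (i != c)) weight i x)%R.
    by apply: sumr_ge0 => b _; rewrite leNgt x0.
  by move: (\sum_(_ < q | _) _)%R => s; clear; lia.
have := le1 u (f [set u; v]) uX uI; have := le1 v (f [set u; v]) vX vI.
by rewrite /chi eqxx /=; clear; lia.
Qed.

(** Of two adjacent common neighbors of u and u' at least one, w, is ordinary; the unique color of
    an ordinary vertex passes along uv, uw, u'w, u'v'. *)
Lemma ordinary_monochromatic u v u' v' :
    u \notin X -> v \notin X -> u \notin exceptional -> v \notin exceptional ->
    u' \notin X -> v' \notin X -> u' \notin exceptional -> v' \notin exceptional ->
    adj G u v -> adj G u' v' -> f [set u; v] = f [set u'; v'].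
Proof.
move=> uX vX uI vI u'X v'X u'I v'I uv uv'.
have [|//|z zX lz] := @common_nbr [:: u; u'] X; first by rewrite /=; move: r_ge3; clear; lia.
have [|//|t tX lt] := @common_nbr [:: u; u'; z] X; first by rewrite /=; move: r_ge3; clear; lia.
have [uz uz'] : adj G u z /\ adj G u' z by split; apply: lz; rewrite !inE eqxx ?orbT.
have [ut ut' zt] : [/\ adj G u t, adj G u' t & adj G z t].
  by split; apply: lt; rewrite !inE eqxx ?orbT.
have [w [wX wI uw uw']] : exists w, [/\ w \notin X, w \notin exceptional, adj G u w & adj G u' w].
  have [zI|zI] := boolP (z \in exceptional); last by exists z.
  exists t; split=> //; apply: contraL zt; exact: exceptional_indep.
have cu := ordinary_color uX uI (ordinary_edge uX vX uI vI uv) (ordinary_edge uX wX uI wI uw).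
have cu' := ordinary_color u'X u'I (ordinary_edge u'X v'X u'I v'I uv')
  (ordinary_edge u'X wX u'I wI uw').
rewrite cu cu'; apply: (ordinary_color wX wI).
  by rewrite setUC; apply: ordinary_edge; rewrite // adj_sym.
by rewrite setUC; apply: ordinary_edge; rewrite // adj_sym.
Qed.

Lemma card_exceptional : r.+1 * (#|exceptional| + h) <= #|V|.
Proof.
have [->|/set0Pn[u uI]] := eqVneq exceptional set0.
  by rewrite cards0; apply: rh_le.
apply: leq_trans (nonnbr_le u); rewrite leq_mul2l leq_add2r /=.
by apply/subset_leq_card/subsetP=> v vI; rewrite inE exceptional_indep.
Qed.

End NoSwitch.

End Dense.

(** * From rigidity to an unbalanced tiling *)

Lemma bin2_le_sub k j : 'C(k + j, 2) <= 'C(k, 2) + j * (k + j - 1).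
Proof.
elim: j => [|j IH]; first by rewrite addn0 mul0n addn0.
rewrite addnS binS bin1 subSS subn0 mulSn; move: IH.
have : j * (k + j - 1) <= j * (k + j) by rewrite leq_mul2l leq_subr orbT.
by clear; move: (j * _) (j * _) ('C(_, _)) ('C(_, _)) => *; lia.
Qed.

(** Each vertex of J lies in r - 1 pairs of its block, and all pairs avoiding J have color c. *)
Lemma cnt_monochromatic (V : finType) (G : sgraph V) r q (f : {set V} -> 'I_q)
    (P : {set {set V}}) (J : {set V}) c :
    0 < r -> Kr_partition G r P [set: V] ->
    {in ~: J &, forall x y, adj G x y -> f [set x; y] = c} ->
  (#|V| %/ r) * 'C(r, 2) <= cnt f c P + (r - 1) * #|J|.
Proof.
move=> r0 PV JP; have := PV; case/andP=> pP _.
have <- : \sum_(B in P) 'C(r, 2) = (#|V| %/ r) * 'C(r, 2).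
  rewrite -cardsT -(sum_cnt r0 f PV) /cnt exchange_big /=.
  by apply: eq_bigr => B BP; rewrite sum_pairs; have [->] := Kr_partition_block PV BP.
have <- : \sum_(B in P) #|B :&: J| = #|J|.
  transitivity (\sum_(x in [set: V]) (x \in J : nat)).
    rewrite (set_partition_big _ pP); apply: eq_bigr => B _.
    rewrite -sum1_card big_mkcond [RHS]big_mkcond; apply: eq_bigr => x _.
    by rewrite inE; case: (x \in B); case: (x \in J).
  by rewrite -sum1_card [RHS]big_mkcond; apply: eq_big => x; rewrite ?inE.
rewrite big_distrr -big_split; apply: leq_sum => B BP /=.
have [cB /cliqueP clB _] := Kr_partition_block PV BP.
have cBJ := cardsID J B; rewrite cB in cBJ.
apply: leq_trans (_ : 'C(#|B :\: J|, 2) + (r - 1) * #|B :&: J| <= _).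
  have := bin2_le_sub #|B :\: J| #|B :&: J|.
  by rewrite [#|B :\: J| + _]addnC cBJ [#|_| * _]mulnC.
rewrite leq_add2r -cards_draws; apply/subset_leq_card/subsetP=> e.
rewrite !inE => /andP[eBJ e2]; rewrite e2 (subset_trans eBJ) ?subsetDl //=.
case/cards2P: e2 => x [y [xy eE]]; subst e.
move: eBJ; rewrite subUset !sub1set !in_setD => /andP[/andP[xJ xB] /andP[yJ yB]].
by rewrite (JP x y) ?inE // clB.
Qed.

Theorem dense_unbalanced_tiling (V : finType) (G : sgraph V) r q m (f : {set V} -> 'I_q) :
    3 <= r -> 2 <= q -> 0 < m -> 0 < #|V| -> r %| #|V| ->
    (forall v, r.+1 * (#|nonnbr G v| + (2 * r * q + 1) * m) <= #|V|) ->
  exists P c, Kr_partition G r P [set: V] /\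
    (#|V| %/ r) * 'C(r, 2) + m <= q * cnt f c P.
Proof.
(* Up to 2 r m vertices are deleted for each of the q colors; the additional m is the gain to be
   kept. *)
move=> r3 q2 m0 V0 rV nn; set h := (2 * r * q + 1) * m.
have r0 : 0 < r by apply: leq_trans r3.
have h0 : 0 < h by rewrite muln_gt0 addn1.
have rh := rh_le V0 nn.
have le2h : 2 * m <= h by rewrite leq_mul2r; move: r3 q2; clear; nia.
have rnn v : r * #|nonnbr G v| + r * h <= #|V|.
  by apply: leq_trans (nn v); rewrite -mulnDr leq_mul2r leqnSn orbT.
pose goal := exists P c, Kr_partition G r P [set: V] /\
    (#|V| %/ r) * 'C(r, 2) + m <= q * cnt f c P.
(* [None] records that color c has enough switchers to finish, [Some X] a small set meeting all its
   switchers. *)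
have [|F FP] := @fin_all_exists 'I_q (fun=> option {set V}) (fun c o =>
    if o is Some X then #|X| <= 2 * r * m /\
      forall u v A B, switch G r f c u v A B -> ~~ [disjoint u |: A :|: (v |: B) & X]
    else goal).
  move=> c; have [[X cX XP]|[X cX XP]] := many_switches G f r3 c m; last by exists (Some X).
  exists None; pose S := ~: X.
  have cS : #|S| = #|V| - r * (2 * m) by rewrite cardsCs setCK cX mulnAC mulnC.
  have rS : r %| #|S|.
    by rewrite cS dvdn_sub // dvdn_mulr.
  have [//|v vS|P0 PS0] := @exists_Kr_partition V G r r0 S.
    rewrite leq_divRL // cS mulnC; apply: leq_trans (_ : r * #|nonnbr G v| <= _).
      by rewrite leq_mul2l subset_leq_card ?subsetIr ?orbT.
    have := rnn v; have : r * (2 * m) <= r * h by rewrite leq_mul2l le2h orbT.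
    by move: (r * _) (r * _) (r * _) => x y z; clear; lia.
  have dXS : [disjoint X & S] by rewrite disjoints_subset setCK.
  have [P1 [P2 []]] := XP P0 S PS0 dXS.
  rewrite setUCr => PS1 PS2 gap.
  by have := unbalanced_of_gap r0 PS1 PS2 gap; rewrite cardsT.
have [/existsP[c /eqP Fc]|] := boolP [exists c, F c == None].
  by have := FP c; rewrite Fc.
rewrite negb_exists => /forallP FS; pose Xc c := odflt set0 (F c).
have XcP c : #|Xc c| <= 2 * r * m /\
      forall u v A B, switch G r f c u v A B -> ~~ [disjoint u |: A :|: (v |: B) & Xc c].
  by have := FP c; rewrite /Xc; case: (F c) (FS c).
pose X := \bigcup_c Xc c.
have cX : #|X| <= q * (2 * r * m).
  apply: leq_trans (_ : \sum_(c < q) #|Xc c| <= _).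
    rewrite /X; elim/big_rec2: _ => [|c n Y _ leY]; first by rewrite cards0.
    by apply: leq_trans (leq_card_setU _ _) _; rewrite leq_add2l.
  rewrite -[q in q * _]card_ord -sum_nat_const.
  by apply: leq_sum => c _; have [] := XcP c.
have noX c u v A B : switch G r f c u v A B -> ~~ [disjoint u |: A :|: (v |: B) & X].
  move=> sw; have [_ /(_ _ _ _ _ sw)] := XcP c; apply: contraNN.
  by apply: disjointWr; apply: bigcup_sup.
have Xh : #|X| + m <= h.
  rewrite /h mulnDl mul1n leq_add2r; apply: leq_trans cX _.
  by rewrite mulnCA mulnA mulnAC.
have X_small : #|X| + r < r.+1 * h.
  rewrite mulSn; apply: leq_trans (_ : h + r <= _); last by rewrite leq_add2l leq_pmulr.
  by move: Xh m0; clear; lia.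
pose I := exceptional G f X; pose J := I :|: X.
have cJ : #|J| <= #|I| + #|X| by apply: leq_card_setU.
have [P0 PV] : exists P, Kr_partition G r P [set: V].
  apply: exists_Kr_partition => //; rewrite cardsT // => v _.
  rewrite setTI leq_divRL // mulnC; apply: leq_trans (rnn v); exact: leq_addr.
have [c mono] : exists c, {in ~: J &, forall x y, adj G x y -> f [set x; y] = c}.
  have [/existsP[[u v] /= /and3P[uJ vJ uv]]|] := boolP [exists p : V * V,
    [&& p.1 \in ~: J, p.2 \in ~: J & adj G p.1 p.2]].
    exists (f [set u; v]) => x y xJ yJ xy.
    move: uJ vJ xJ yJ; rewrite !in_setC !in_setU !negb_or.
    case/andP=> uI uX /andP[vI vX] /andP[xI xX] /andP[yI yX].
    by apply: (ordinary_monochromatic r3 V0 nn X_small noX).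
  rewrite negb_exists => /forallP noE; exists (Ordinal (ltnW q2)) => x y xJ yJ xy.
  by have := noE (x, y); rewrite xJ yJ xy.
exists P0, c; split=> //.
have := cnt_monochromatic r0 PV mono; have := card_exceptional r3 V0 nn X_small noX.
rewrite -/I => cI; set E := _ * 'C(r, 2) => leE.
have E2 : E * 2 = #|V| * (r - 1).
  rewrite /E -mulnA -[in RHS](divnK rV) -mulnA; congr (_ * _).
  by rewrite -[2]/(2`!) bin_ffact ffactnS ffactn1 subn1.
(* That is, 1 / (r + 1) <= (1 - 1 / q) / 2, with equality for r = 3 and q = 2. *)
have k1 : 2 * q <= (q - 1) * r.+1 by move: q2 r3; clear; nia.
have k2 : 2 * q * (#|J| + m) <= (q - 1) * #|V|.
  apply: leq_trans (leq_mul k1 (_ : #|J| + m <= #|I| + h)) _.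
    by move: cJ Xh; clear; lia.
  by rewrite -mulnA leq_mul2l cI orbT.
have k3 := leq_mul k2 (leqnn (r - 1)); rewrite -[in X in _ <= X]mulnA -E2 in k3.
have k4 : q * m * (r - 1) >= m.
  by rewrite -mulnA mulnCA leq_pmulr // muln_gt0 subn_gt0 (ltnW q2) (ltnW r3).
have k5 := leq_mul (leqnn q) leE; move: k3 k4 k5 q2.
move: (r - 1) #|J| (cnt f c P0) (E) => p j x n; clear; case: q => // q.
rewrite subn1 /=; nia.
Qed.

(* From finite tilings to the threshold *)
From mathcomp Require Import boolp classical_sets reals.
From mathcomp Require Import ring lra.

Local Open Scope ring_scope.

Theorem theorem1p5 (R : realType) (r q : nat) (hr : (3 <= r)%N) (hq : (2 <= q)%N) :
  tiling_discrepancy_threshold R r q <= r%:R / (r%:R + 1).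
Proof.
have q0 : (0 < q)%N by apply: leq_trans hq.
apply/ler_addgt0Pr => eps eps0; apply: ge_inf.
  by case: (has_inf_tiling_discrepancy_set R r q).
pose N := (2 * r * q + 1)%N; have N0 : 0 < N%:R :> R by rewrite ltr0n /N addn1.
split; first by rewrite ltr_wpDl // divr_ge0 // ?addr_ge0.
(* The slack eps n in the degree must cover N m, so m is eps n / N rounded down; the factor 2 pays
   for the rounding. *)
exists (eps / (2 * N%:R)); split; first by rewrite divr_gt0 // mulr_gt0.
(* Makes eps n / N exceed 2, so that its integer part m is positive and at least half of it. *)
exists (Num.truncn (2 * N%:R / eps)).+1 => n n0 rn V G Vn degG f.
have n_gt : 2 * N%:R / eps < n%:R :> R.
  by apply: lt_le_trans (truncnS_gt _) _; rewrite ler_nat.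
pose x : R := eps * n%:R / N%:R; pose m := Num.truncn x.
have x2 : 2 < x.
  by rewrite /x ltr_pdivlMr // [ltRHS]mulrC -ltr_pdivrMr.
have mx : m%:R <= x by rewrite truncn_le // ltW // (lt_trans _ x2).
have xm : x < m%:R + 1 by rewrite natr1 truncnS_gt.
have [P [c [PV PcE]]] : exists P c, Kr_partition G r P [set: V]%SET /\
    ((#|V| %/ r) * 'C(r, 2) + m <= q * cnt f c P)%N.
  apply: dense_unbalanced_tiling => //.
  - by rewrite -(ltr_nat R) (lt_trans _ (_ : 1 < m%:R)) // -(ltrD2r 1) (le_lt_trans _ xm) // ltW.
  - by rewrite Vn -(ltr_nat R) (le_lt_trans _ n_gt) // divr_ge0 ?mulr_ge0 // ltW.
  - by rewrite Vn.
  - move=> v; rewrite card_nonnbr -(ler_nat R) natrM natrD natrB ?(ltnW (degree_lt G v)) //.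
    rewrite Vn -/N [(N * m)%:R]natrM.
    have Nm : N%:R * m%:R <= eps * n%:R :> R.
      by rewrite mulrC -ler_pdivlMr.
    have dv : (r%:R / (r%:R + 1) + eps) * n%:R <= (degree G v)%:R :> R.
      by apply: le_trans degG _; rewrite ler_nat min_degree_le.
    have r1 : 0 < r%:R + 1 :> R by rewrite ltr_wpDl.
    rewrite -natr1 -[leRHS]mul1r.
    have -> : 1 * n%:R = (r%:R + 1) * (n%:R - (r%:R / (r%:R + 1) + eps) * n%:R + eps * n%:R) :> R.
      by field; rewrite gt_eqF.
    by rewrite ler_pM2l // lerD // lerB.
exists P; split; first exact: PV.
have [_ ub] := discrepancy_max R (tiling_graph P) f q0.
apply: le_trans (_ : m%:R <= _).
  have -> : eps / (2 * N%:R) * n%:R = x / 2 :> R by rewrite /x; field; rewrite gt_eqF.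
  by move: xm x2; clear; move: (m%:R) => y; lra.
apply: ub; exists c.
rewrite (card_edges_tiling (ltnW (ltnW hr)) f PV) (card_color_class _ _ PV) cardsT.
by rewrite ler_pdivrMr ?ltr0n // -natrD -natrM ler_nat [leqRHS]mulnC.
Qed.
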